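(* Let $F_2=\langle a,b\rangle$ be the free group with free basis $a,b$, let $u,v\in F_2$ be any elements, and let $G=\langle a,b\mid uvu^{-1}v^{-1}\rangle$. Suppose that $uvu^{-1}v^{-1}$, when reduced and cyclically reduced, is not equal to $aba^{-1}b^{-1}$, $bab^{-1}a^{-1}$ or any of their cyclic conjugates. Then $G$ is large or is NARA.
   Context: A finitely generated group is large if it has a finite index subgroup possessing a homomorphism onto a non-abelian free group. A finitely generated group $G$ is NARA (non-abelian residually abelianised) if it is non-abelian and the intersection of all finite index subgroups of $G$ equals the commutator subgroup $G'$. *)

(* Defs.v *)
From HB Require Import structures.
From mathcomp Require Import all_boot.
From mathcomp Require Import generic_quotient.
From mathcomp Require Import all_classical.

Set Implicit Arguments.
Unset Strict Implicit.
Unset Printing Implicit Defensive.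

Local Open Scope classical_set_scope.
Local Open Scope quotient_scope.
Local Open Scope group_scope.

Section Words.
Variable X : choiceType.

(* The letter (x, false) stands for x and (x, true) for x^-1. *)
Local Notation letter := (X * bool)%type.

Definition invl (l : letter) : letter := (l.1, ~~ l.2).
Definition invw (w : seq letter) : seq letter := rev (map invl w).

Definition reduced (w : seq letter) : bool :=
  sorted (fun l m => m != invl l) w.

Definition cons_red (l : letter) (w : seq letter) : seq letter :=
  if w is m :: w' then (if m == invl l then w' else l :: w) else [:: l].

Definition reduce (w : seq letter) : seq letter := foldr cons_red [::] w.

(* The fuel n only has to be at least size w. *)
Fixpoint cyc_reduce_rec (n : nat) (w : seq letter) : seq letter :=
  match n, w with
  | n'.+1, l :: w' =>
      if last l w' == invl l then cyc_reduce_rec n' (behead (belast l w')) else w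
  | _, _ => w
  end.

(* Meaningful on a reduced word w: the word c such that w is literally
   p ++ c ++ invw p, with c cyclically reduced (see cyc_reduceP). *)
Definition cyc_reduce (w : seq letter) : seq letter := cyc_reduce_rec (size w) w.

Lemma invlK : involutive invl.
Proof. by case=> x e; rewrite /invl /= negbK. Qed.

Lemma invl_neq l : (l == invl l) = false.
Proof. by case: l => x [] ; apply/eqP => -[]. Qed.

Lemma invwK : involutive invw.
Proof. by move=> w; rewrite /invw map_rev revK mapK //; apply: invlK. Qed.

Lemma cons_red_reduced l w : reduced w -> reduced (cons_red l w).
Proof.
case: w => [|m w] //= rw; case: eqP => [_|/eqP ne]; first exact: path_sorted rw.
by rewrite /= ne.
Qed.

Lemma foldr_reduced s w : reduced w -> reduced (foldr cons_red w s).
Proof. by move=> rw; elim: s => //= l s; apply: cons_red_reduced. Qed.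

Lemma reduce_reduced w : reduced (reduce w).
Proof. exact: foldr_reduced. Qed.

Lemma reduce_id w : reduced w -> reduce w = w.
Proof.
elim: w => //= l w IH rw; rewrite IH; last exact: path_sorted rw.
by case: w rw {IH} => //= m w /andP[/negbTE-> _].
Qed.

Lemma cons_redK l w : reduced w -> cons_red (invl l) (cons_red l w) = w.
Proof.
case: w => [|m w] /=; first by rewrite invlK eqxx.
case: (m =P invl l) => [->|/eqP ne] rw /=; last by rewrite invlK eqxx.
by case: w rw => [|k w] //= /andP[/negbTE-> _].
Qed.

Lemma foldr_cons_red l s w : reduced w ->
  foldr cons_red w (cons_red l s) = cons_red l (foldr cons_red w s).
Proof.
move=> rw; case: s => [|m s] //=; case: eqP => [->|] //=.
by have := cons_redK (invl l) (foldr_reduced s rw); rewrite invlK.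
Qed.

Lemma foldr_reduce s w : reduced w ->
  foldr cons_red w (reduce s) = foldr cons_red w s.
Proof. by move=> rw; elim: s => //= l s IH; rewrite foldr_cons_red // IH. Qed.

Lemma reduce_catl s t : reduce (reduce s ++ t) = reduce (s ++ t).
Proof.
by rewrite /reduce !foldr_cat foldr_reduce //; apply: reduce_reduced.
Qed.

Lemma reduce_catr s t : reduce (s ++ reduce t) = reduce (s ++ t).
Proof.
by rewrite /reduce !foldr_cat -!/(reduce _) (reduce_id (reduce_reduced t)).
Qed.

Lemma reduce_invl s : reduce (invw s ++ s) = [::].
Proof.
rewrite /reduce foldr_cat -!/(reduce _).
elim: s => //= l s IH; rewrite /invw /= rev_cons foldr_rcons.
by rewrite cons_redK ?reduce_reduced.
Qed.

Lemma invw_reduced w : reduced w -> reduced (invw w).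
Proof.
rewrite /reduced /invw rev_sorted sorted_map.
rewrite (@eq_sorted _ (relpre invl _) (fun l m : letter => m != invl l)) //.
by move=> l m /=; rewrite invlK eq_sym.
Qed.

Lemma cyc_reduceP w : reduced w ->
  (exists p, w = p ++ cyc_reduce w ++ invw p) /\
  (forall l s, cyc_reduce w = l :: s -> last l s <> invl l).
Proof.
rewrite /cyc_reduce; move: {2 3 4}(size w) (leqnn (size w)) => n.
elim: n w => [|n IH] [|l w] //= sw rw; try by split=> //; exists [::].
case: eqP => [e|ne]; last first.
  split; first by exists [::]; rewrite /= cats0.
  by move=> l' s [<- <-].
case/lastP: w e sw rw => [|w m] /=; first by move/eqP; rewrite invl_neq.
rewrite last_rcons belast_rcons size_rcons => -> sw rw /=.
have rw' : reduced w.
  by have := path_sorted rw; rewrite /reduced -cats1 => /cat_sorted2[].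
have [[p e] c] := IH w (ltnW sw) rw'; split=> //; exists (l :: p).
by rewrite {1}e /invw /= rev_cons -!rcons_cat.
Qed.

End Words.

Section FreeGroup.
Variable X : choiceType.

Record free_group : Type :=
  FreeGroup { fword :> seq (X * bool); _ : reduced fword }.
HB.instance Definition _ := [isSub for fword].
HB.instance Definition _ := [Choice of free_group by <:].

Definition fmk (w : seq (X * bool)) : free_group := FreeGroup (reduce_reduced w).
Definition fone : free_group := fmk [::].
Definition fmul (x y : free_group) : free_group := fmk (fword x ++ fword y).
Definition finv (x : free_group) : free_group := fmk (invw (fword x)).

Lemma fmulA : associative fmul.
Proof.
by move=> x y z; apply: val_inj; rewrite /= reduce_catl reduce_catr catA.
Qed.
Lemma fmul1g : left_id fone fmul.
Proof. by case=> x rx; apply: val_inj; rewrite /= reduce_id. Qed.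
Lemma fmulg1 : right_id fone fmul.
Proof. by case=> x rx; apply: val_inj; rewrite /= cats0 reduce_id. Qed.
Lemma fmulVg : left_inverse fone finv fmul.
Proof. by move=> x; apply: val_inj; rewrite /= reduce_catl reduce_invl. Qed.
Lemma fmulgV : right_inverse fone finv fmul.
Proof.
move=> x; apply: val_inj; rewrite /= reduce_catr.
by rewrite -{1}[fword x]invwK reduce_invl.
Qed.
HB.instance Definition _ :=
  isGroup.Build free_group fmulA fmul1g fmulg1 fmulVg fmulgV.

Definition fgen (x : X) : free_group := fmk [:: (x, false)].
End FreeGroup.

Definition abelian_group (G : groupType) : Prop := forall x y : G, commute x y.

Section Subgroups.
Variable G : groupType.
Implicit Types (H N S : set G).

Definition subgroup H : Prop :=
  [/\ H 1, forall x y, H x -> H y -> H (x * y) & forall x, H x -> H x^-1].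

Definition normal_subgroup N : Prop :=
  subgroup N /\ forall x g, N x -> N (x ^ g).

Definition generated S : set G := smallest subgroup S.
Definition normal_closure S : set G := smallest normal_subgroup S.

Definition finite_index H : Prop :=
  subgroup H /\ finite_set (range (fun g : G => [set g * h | h in H])).

Definition commutator_subgroup : set G :=
  generated [set z | exists x y : G, z = [~ x, y]].

Definition finitely_generated : Prop :=
  exists2 S : set G, finite_set S & generated S = setT.

(* A homomorphism on the subgroup H is the restriction to H of a map on G. *)
Definition large : Prop :=
  finitely_generated /\
  exists (H : set G) (X : choiceType) (f : G -> free_group X),
    [/\ finite_index H,
        ~ abelian_group (free_group X),
        forall x y, H x -> H y -> f (x * y) = f x * f y
      & f @` H = setT].

Definition NARA : Prop :=
  [/\ finitely_generated, ~ abelian_group G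
    & \bigcap_(H in finite_index) H = commutator_subgroup].

Lemma normal_closure_normal S : normal_subgroup (normal_closure S).
Proof.
split; first split.
- by move=> N [[[]]].
- move=> x y nx ny N nN; have [[[_ nM _] _] _] := nN.
  exact: nM (nx _ nN) (ny _ nN).
- move=> x nx N nN; have [[[_ _ nV] _] _] := nN; exact: nV (nx _ nN).
- move=> x g nx N nN; have [[_ nJ] _] := nN; exact: nJ (nx _ nN).
Qed.
End Subgroups.

Section Presentation.
Variables (X : choiceType) (R : set (free_group X)).
Local Notation F := (free_group X).
Local Notation N := (normal_closure R).

Definition pres_rel (x y : F) : bool := `[< N (x^-1 * y) >].

Lemma pres_rel_refl : reflexive pres_rel.
Proof.
move=> x; apply/asboolP; rewrite mulVg.
by have [[]] := normal_closure_normal R.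
Qed.
Lemma pres_rel_sym : symmetric pres_rel.
Proof.
have [[_ _ nV] _] := normal_closure_normal R.
by move=> x y; apply/asboolP/asboolP => /nV; rewrite invgM invgK.
Qed.
Lemma pres_rel_trans : transitive pres_rel.
Proof.
have [[_ nM _] _] := normal_closure_normal R.
move=> y x z /asboolP xy /asboolP yz; apply/asboolP.
by have := nM _ _ xy yz; rewrite -mulgA mulVKg.
Qed.
Canonical pres_equiv := EquivRel pres_rel pres_rel_refl pres_rel_sym pres_rel_trans.

(* The group <X | R>: the free group on X modulo the normal closure of R. *)
Definition presented_group : Type := {eq_quot pres_equiv}.
HB.instance Definition _ := Choice.on presented_group.
HB.instance Definition _ := EqQuotient.on presented_group.
Local Notation Q := presented_group.

Definition pres_one : Q := \pi_Q 1.
Definition pres_mul (x y : Q) : Q := \pi_Q (repr x * repr y).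
Definition pres_inv (x : Q) : Q := \pi_Q (repr x)^-1.

Lemma pres_eqP (x y : F) : \pi_Q x = \pi_Q y <-> N (x^-1 * y).
Proof.
split; first by move/eqP; rewrite eqmodE => /asboolP.
by move=> h; apply/eqP; rewrite eqmodE; apply/asboolP.
Qed.

Lemma pres_piM (x y : F) : pres_mul (\pi_Q x) (\pi_Q y) = \pi_Q (x * y).
Proof.
have [[_ nM _] nJ] := normal_closure_normal R.
rewrite /pres_mul; case: piP => x' /pres_eqP xx'; case: piP => y' /pres_eqP yy'.
apply/esym/pres_eqP; have := nM _ _ (nJ _ y xx') yy'.
by rewrite /conjg invgM -!mulgA mulVKg.
Qed.

Lemma pres_piV (x : F) : pres_inv (\pi_Q x) = \pi_Q x^-1.
Proof.
have [_ nJ] := normal_closure_normal R.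
rewrite /pres_inv; case: piP => x' /pres_eqP xx'.
apply/pres_eqP; have := nJ _ x^-1 xx'.
by rewrite /conjg !invgK -!mulgA mulVKg.
Qed.

Lemma pres_mulA : associative pres_mul.
Proof.
move=> x y z; elim/quotW: x => x; elim/quotW: y => y; elim/quotW: z => z.
by rewrite (pres_piM y z) (pres_piM x y) (pres_piM x) (pres_piM _ z) mulgA.
Qed.
Lemma pres_mul1g : left_id pres_one pres_mul.
Proof. by elim/quotW=> x; rewrite pres_piM mul1g. Qed.
Lemma pres_mulg1 : right_id pres_one pres_mul.
Proof. by elim/quotW=> x; rewrite pres_piM mulg1. Qed.
Lemma pres_mulVg : left_inverse pres_one pres_inv pres_mul.
Proof. by elim/quotW=> x; rewrite pres_piV pres_piM mulVg. Qed.
Lemma pres_mulgV : right_inverse pres_one pres_inv pres_mul.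
Proof. by elim/quotW=> x; rewrite pres_piV pres_piM mulgV. Qed.
HB.instance Definition _ := isGroup.Build presented_group
  pres_mulA pres_mul1g pres_mulg1 pres_mulVg pres_mulgV.
End Presentation.

Definition F2 : groupType := free_group bool.
Definition a : F2 := fgen false.
Definition b : F2 := fgen true.

Definition cyclic_conjugate (X : choiceType) (w w' : seq (X * bool)) : Prop :=
  exists k, w = rot k w'.

(* Main.v *)
From HB Require Import structures.
From mathcomp Require Import all_boot all_order all_algebra fingroup perm.
From mathcomp Require Import generic_quotient finmap.
From mathcomp Require Import all_classical.
From mathcomp Require Import zify ring.
Require Import Defs.

(** Write G = <a, b | r> with r = [u, v].

    Suppose first that some finite quotient P of G is not generated by the images of u and v. In the
    cover of the presentation complex attached to P, the 2-cells over an orbit of <u, v> glue to a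
    closed torus, because r is the commutator of u and v. As the Euler characteristic vanishes,
    each such torus raises the first Betti number, and as there are at least two orbits there is a
    character of infinite order that is trivial on one of the tori. In the infinite
    cyclic cover defined by this character that torus lifts, which makes one relator equation
    redundant in each level; so there is a finitely supported cocycle f which is not a coboundary.
    Copying f periodically with a large period k, and letting a stable letter s record the passages
    from one period to the next, maps a finite index subgroup to the free group <s, z>, with
    non-abelian image. That image is itself free, so G is large.

    Otherwise every finite quotient of G is generated by the commuting images of u and v, hence
    abelian; since G abelianises to Z^2, which is residually finite, the finite index subgroups
    of G intersect in G'. It remains to see that G is not abelian. If it is, then [a, b] lies in
    the normal closure of r, and Magnus's rewriting together with the Freiheitssatz forces r to be
    conjugate to [a, b] or its inverse. The HNN extensions in the proof of the Freiheitssatz are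
    realised by permutations of a set. *)

Set Implicit Arguments.
Unset Strict Implicit.
Unset Printing Implicit Defensive.

Local Open Scope classical_set_scope.
Local Open Scope quotient_scope.
Local Open Scope group_scope.

(** * Actions and homomorphisms of free groups *)

Section Action.
Variables (X : choiceType) (T : Type).

(* A right action: words act letter by letter, from left to right. *)
Record faction := FAction {
  fstep : X * bool -> T -> T;
  fstepK : forall l, cancel (fstep l) (fstep (invl l)) }.

Definition act (A : faction) (w : seq (X * bool)) (t : T) : T :=
  foldl (fun t l => fstep A l t) t w.

Variable A : faction.

Lemma act_cat w w' t : act A (w ++ w') t = act A w' (act A w t).
Proof. by rewrite /act foldl_cat. Qed.

Lemma act_reduce w t : act A (reduce w) t = act A w t.
Proof.
elim: w t => [|l w IH] t //=; rewrite -IH /cons_red.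
by case: (reduce w) => [|m w'] //; case: eqP => [->|] //=; rewrite fstepK.
Qed.

Lemma actM (x y : free_group X) t : act A (x * y) t = act A y (act A x t).
Proof. by rewrite act_reduce act_cat. Qed.

Lemma actK (x : free_group X) : cancel (act A x) (act A x^-1).
Proof. by move=> t; rewrite -actM mulgV. Qed.

Lemma actVK (x : free_group X) : cancel (act A x^-1) (act A x).
Proof. by move=> t; rewrite -actM mulVg. Qed.

Lemma act_normal_closure (R : set (free_group X)) :
  (forall r t, R r -> act A r t = t) ->
  forall n t, normal_closure R n -> act A n t = t.
Proof.
move=> RA n t; pose N := [set n : free_group X | forall t, act A n t = t].
suff nN : normal_subgroup N by move=> /(_ N); apply; split=> // r Rr u; apply: RA.
split; first split=> //.
- by move=> x y Nx Ny u; rewrite actM Nx Ny.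
- by move=> x Nx u; rewrite -{1}(Nx u) actK.
- by move=> x g Nx u; rewrite /conjg !actM Nx actVK.
Qed.

Section Presented.
Variable R : set (free_group X).
Hypothesis RA : forall r t, R r -> act A r t = t.

(** Relators act trivially, so the chosen representative of a class is immaterial and the presented
    group itself acts. *)
Lemma act_repr (w : free_group X) t :
  act A (repr (\pi_(presented_group R) w)%qT) t = act A w t.
Proof.
case: piP => w' /pres_eqP ww'.
rewrite -[w'](mulVKg w) actM.
by rewrite (act_normal_closure RA _ ww').
Qed.

Lemma act_reprM (g h : presented_group R) t :
  act A (repr (g * h)) t = act A (repr h) (act A (repr g) t).
Proof. by rewrite act_repr actM. Qed.

Lemma act_repr1 t : act A (repr (1 : presented_group R)) t = t.
Proof. by rewrite act_repr. Qed.
End Presented.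

End Action.

Section Bijections.
Variables (X : choiceType) (T : Type) (g g' : X -> T -> T).
Hypotheses (gK : forall x, cancel (g x) (g' x)) (g'K : forall x, cancel (g' x) (g x)).

Definition bij_step (l : X * bool) := if l.2 then g' l.1 else g l.1.

Lemma bij_stepK l : cancel (bij_step l) (bij_step (invl l)).
Proof. by case: l => x []; [apply: g'K | apply: gK]. Qed.

Definition bij_action := FAction bij_stepK.
End Bijections.

Section Eval.
Variables (X : choiceType) (K : groupType) (h : X -> K).

Definition evl (l : X * bool) : K := if l.2 then (h l.1)^-1 else h l.1.
(** On reduced words this is the homomorphism from the free group that extends [h]; unreduced words
    are allowed so that it can be computed before reduction. *)
Definition ev (w : seq (X * bool)) : K := foldr (fun l k => evl l * k) 1 w.

Lemma evlV l : evl (invl l) = (evl l)^-1.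
Proof. by case: l => x []; rewrite /evl //= invgK. Qed.

Lemma ev_cat w w' : ev (w ++ w') = ev w * ev w'.
Proof. by elim: w => [|l w IH] /=; rewrite ?mul1g // IH mulgA. Qed.

Lemma ev_reduce w : ev (reduce w) = ev w.
Proof.
elim: w => [|l w IH] //=; rewrite -IH /cons_red.
case: (reduce w) => [|m w'] //; case: eqP => [->|] //=.
by rewrite evlV mulgA mulgV mul1g.
Qed.

Lemma evM (x y : free_group X) : ev (x * y) = ev x * ev y.
Proof. by rewrite ev_reduce ev_cat. Qed.

Lemma evV (x : free_group X) : ev x^-1 = (ev x)^-1.
Proof. by apply/esym/mulg1_eq; rewrite -evM mulgV. Qed.

Lemma evJ (x y : free_group X) : ev (x ^ y) = ev x ^ ev y.
Proof. by rewrite /conjg !evM evV. Qed.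

Lemma ev_fmk w : ev (fmk w) = ev w.
Proof. by rewrite ev_reduce. Qed.

Lemma ev_gen x : ev (fgen x) = h x.
Proof. by rewrite /= mulg1. Qed.

Lemma ev_normal_closure (R : set (free_group X)) (N : set K) :
  normal_subgroup N -> (forall r, R r -> N (ev r)) ->
  forall n, normal_closure R n -> N (ev n).
Proof.
move=> [[N1 NM NV] NJ] RN n.
suff nN : normal_subgroup [set n : free_group X | N (ev n)].
  by move=> /(_ [set n : free_group X | N (ev n)]); apply; split.
split; first split=> //=.
- by move=> x y Nx Ny; rewrite /= evM; apply: NM.
- by move=> x Nx /=; rewrite evV; apply: NV.
- by move=> x g Nx /=; rewrite evJ; apply: NJ.
Qed.
End Eval.

Lemma normal_closure_sub (G : groupType) (S : set G) : S `<=` normal_closure S.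
Proof. by move=> x Sx N [_]; apply. Qed.

Lemma normal_closure_min (G : groupType) (S N : set G) :
  normal_subgroup N -> S `<=` N -> normal_closure S `<=` N.
Proof. by move=> nN SN x; apply. Qed.

Lemma free_word_eq (X : choiceType) (x y : free_group X) : fword x = fword y -> x = y.
Proof. exact: val_inj. Qed.

Lemma fmk_word (X : choiceType) (x : free_group X) : fmk x = x.
Proof. by apply: val_inj; rewrite /= reduce_id //; case: x. Qed.

Lemma fmk_cat (X : choiceType) (w w' : seq (X * bool)) : fmk (w ++ w') = fmk w * fmk w'.
Proof. by apply: val_inj; rewrite /= reduce_catl reduce_catr. Qed.

Lemma fmk_invw (X : choiceType) (w : seq (X * bool)) : fmk (invw w) = (fmk w)^-1.
Proof.
apply/esym/mulg1_eq; rewrite -fmk_cat; apply: val_inj => /=.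
by rewrite -{1}[w]invwK reduce_invl.
Qed.

Lemma ev_fgen (X : choiceType) (w : seq (X * bool)) : ev (@fgen X) w = fmk w.
Proof.
elim: w => [|[x e] w IH] //=; rewrite IH -cat1s fmk_cat; congr (_ * _).
by case: e => //; rewrite /evl /= -fmk_invw.
Qed.

Lemma ev_comp (X : choiceType) (K K' : groupType) (h : X -> K) (f : K -> K') :
  {morph f : x y / x * y} -> forall w, f (ev h w) = ev (f \o h) w.
Proof.
move=> fM; have f1 : f 1 = 1 by apply: (mulgI (f 1)); rewrite -fM !mulg1.
have fV x : f x^-1 = (f x)^-1 by apply/esym/mulg1_eq; rewrite -fM mulgV f1.
elim=> [|[x e] w IH] //=; rewrite fM IH; congr (_ * _).
by case: e => //; rewrite /evl /= fV.
Qed.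

Lemma eq_ev (X : choiceType) (K : groupType) (h h' : X -> K) (w : seq (X * bool)) :
  (forall l, l \in w -> h l.1 = h' l.1) -> ev h w = ev h' w.
Proof.
elim: w => [|l w IH] //= H; rewrite IH => [|m mw]; last by apply: H; rewrite inE mw orbT.
by rewrite /evl H ?mem_head.
Qed.

Lemma fmk_neg (X : choiceType) (x : X) : fmk [:: (x, true)] = (fgen x)^-1.
Proof. exact: (fmk_invw [:: (x, false)]). Qed.

Lemma F2_nonabelian : ~ abelian_group F2.
Proof. by move=> /(_ a b) /(congr1 (@fword bool)). Qed.

(** * Cocycles, and subgroups of F2 *)

(* [h x t] labels the edge from t to t.x; [coc w t] is the product of the labels along the path w
   starting at t. *)
Section Cocycle.
Variables (X : choiceType) (T : Type) (A : faction X T) (K : groupType) (h : X -> T -> K).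

Definition cocl (l : X * bool) (t : T) : K :=
  if l.2 then (h l.1 (fstep A l t))^-1 else h l.1 t.

Fixpoint coc (w : seq (X * bool)) (t : T) : K :=
  if w is l :: w' then cocl l t * coc w' (fstep A l t) else 1.

Lemma coclV l t : cocl (invl l) (fstep A l t) = (cocl l t)^-1.
Proof.
case: l => x []; rewrite /cocl /= ?invgK //.
by rewrite (fstepK A (x, false)).
Qed.

Lemma coc_cat w w' t : coc (w ++ w') t = coc w t * coc w' (act A w t).
Proof. by elim: w t => [|l w IH] t /=; rewrite ?mul1g // IH mulgA. Qed.

Lemma coc_reduce w t : coc (reduce w) t = coc w t.
Proof.
elim: w t => [|l w IH] t //=; rewrite -IH /cons_red.
case: (reduce w) => [|m w'] //; case: eqP => [->|] //=.
by rewrite coclV fstepK mulgA mulgV mul1g.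
Qed.

Lemma cocM (x y : free_group X) t : coc (x * y) t = coc x t * coc y (act A x t).
Proof. by rewrite coc_reduce coc_cat. Qed.

Lemma cocV (x : free_group X) t : coc x^-1 (act A x t) = (coc x t)^-1.
Proof. by apply/esym/mulg1_eq; rewrite -cocM mulgV. Qed.

Lemma coc_gen x t : coc (fgen x) t = h x t.
Proof. by rewrite /= mulg1. Qed.

(** The skew product of the action with [K]. If the relators fix every point and have trivial label,
    the presented group acts on it, so labels are well defined on the quotient. *)
Definition cstep (l : X * bool) (p : T * K) : T * K := (fstep A l p.1, p.2 * cocl l p.1).
Lemma cstepK l : cancel (cstep l) (cstep (invl l)).
Proof. by case=> t k; rewrite /cstep /= fstepK coclV mulgK. Qed.
Definition cext := FAction cstepK.

Lemma act_cext w t k : act cext w (t, k) = (act A w t, k * coc w t).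
Proof.
elim: w t k => [|l w IH] t k /=; first by rewrite mulg1.
by rewrite -/(act cext w _) IH mulgA.
Qed.

End Cocycle.

(** * Shortlex order on words *)

Section Shortlex.

(* Digits in 1..4 in base 5: comparing codes is comparing words in shortlex order. *)
Definition digit (l : bool * bool) : nat := (1 + l.1 + 2 * l.2)%N.

Fixpoint code (w : seq (bool * bool)) : nat :=
  if w is l :: w' then (digit l * 5 ^ size w' + code w')%N else 0%N.

Lemma code_rcons w l : code (rcons w l) = (5 * code w + digit l)%N.
Proof.
elim: w => [|m w IH] /=; first by rewrite muln1 muln0 addn0.
by rewrite IH size_rcons expnS; lia.
Qed.

Lemma code_inj : injective code.
Proof.
have digit_bound l : (0 < digit l < 5)%N by case: l => [[] []].
elim/last_ind => [|w l IH]; case/lastP=> [|w' l'] //=; rewrite ?code_rcons.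
- by have := digit_bound l'; lia.
- by have := digit_bound l; lia.
have := digit_bound l; have := digit_bound l' => d d' e.
have e1 : code w = code w' by lia.
have e2 : digit l = digit l' by lia.
rewrite (IH _ e1); congr rcons.
by case: l l' e2 {e d d'} => [[] []] [[] []].
Qed.

(** Both bounds are proved together, because the weight of a leading digit depends on the length of
    the tail. *)
Lemma code_reduce w : (size (reduce w) <= size w)%N /\ (code (reduce w) <= code w)%N.
Proof.
elim: w => [|l w [IHs IHc]] //; rewrite [reduce _]/= [code (l :: w)]/= [size (_ :: _)]/=.
have lep : (5 ^ size (reduce w) <= 5 ^ size w)%N by rewrite leq_exp2l.
rewrite /= -/(reduce w) /cons_red; case: (reduce w) IHs IHc lep => [|m u] /= IHs IHc lep.
  by split; nia.
by case: eqP => _ /=; split; nia.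
Qed.

End Shortlex.

Lemma reduced_rcons (X : choiceType) (w : seq (X * bool)) l :
  reduced (rcons w l) -> reduced w.
Proof. by rewrite /reduced -cats1 => /cat_sorted2[]. Qed.

(** * Schreier transversals of subgroups of [F2] *)

Section Transversal.
Variable S : set F2.
Hypothesis sS : subgroup S.

Let S1 : S 1. Proof. by case: sS. Qed.
Let SM x y : S x -> S y -> S (x * y). Proof. by case: sS => _ + _; apply. Qed.
Let SV x : S x -> S x^-1. Proof. by case: sS => _ _; apply. Qed.

(** Picks the shortlex-least element of the right coset of [g] modulo [S]; minimality will make the
    representatives closed under prefixes. *)
Let is_rep (g h : F2) : Prop :=
  S (g * h^-1) /\ forall k : F2, S (g * k^-1) -> (code h <= code k)%N.

Lemma is_rep_ex g : exists h, is_rep g h.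
Proof.
pose P n := `[< exists2 h : F2, S (g * h^-1) & code h = n >].
have exP : exists n, P n by exists (code g); apply/asboolP; exists g; rewrite ?mulgV.
case: (ex_minnP exP) => n /asboolP [h Sh hn] nmin; exists h; split=> // k Sk.
by rewrite hn; apply: nmin; apply/asboolP; exists k.
Qed.

Lemma is_rep_uniq g h h' : is_rep g h -> is_rep g h' -> h = h'.
Proof.
move=> [Sh mh] [Sh' mh']; apply/free_word_eq/code_inj/eqP.
by rewrite eqn_leq mh // mh'.
Qed.

Definition srep (g : F2) : F2 := xget 1 [set h | is_rep g h].

Lemma srepP g : is_rep g (srep g).
Proof. by apply: (xgetPex 1); apply: is_rep_ex. Qed.

Lemma srepE g h : is_rep g h -> srep g = h.
Proof. exact: (is_rep_uniq (srepP g)). Qed.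

Lemma srep_coset g h : S (g * h^-1) -> srep g = srep h.
Proof.
move=> Sgh; apply: srepE; have [Sr mr] := srepP h; split.
  by have := SM Sgh Sr; rewrite mulgA mulgVK.
move=> k Sk; apply: mr; have := SM (SV Sgh) Sk.
by rewrite invgM invgK -!mulgA mulKg.
Qed.

Lemma srep_in g : S (g * (srep g)^-1).
Proof. by case: (srepP g). Qed.

Lemma srepK g : srep (srep g) = srep g.
Proof.
by apply/esym/srep_coset/srep_in.
Qed.

Lemma srep1 : srep 1 = 1.
Proof. by apply: srepE; split; rewrite ?mulgV. Qed.

(** The Schreier property: an element of the coset of [w] that came before [w] would, followed by
    [l], come before [v] in the coset of [v]. *)
Lemma srep_prefix (v : F2) w l : srep v = v -> fword v = rcons w l ->
  srep (fmk w) = fmk w.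
Proof.
move=> rv vE; have rw : reduced w.
  by apply: (@reduced_rcons _ w l); rewrite -vE; case: (v).
have vM : v = fmk w * fmk [:: l] by rewrite -fmk_cat cats1 -vE fmk_word.
apply: srepE; split=> [|k Sk]; first by rewrite mulgV.
rewrite leqNgt /= reduce_id //; apply/negP => lt.
have [_ mv] := srepP v; rewrite rv in mv.
have /mv : S (v * (k * fmk [:: l])^-1) by rewrite vM invgM !mulgA mulgK.
rewrite vE code_rcons; have [_ +] := code_reduce (rcons k l).
by rewrite code_rcons -cats1 => h1 h2; have := leq_trans h2 h1; lia.
Qed.

Let X := bool.
(** The Schreier generator of the edge labelled [x] that leaves the coset of [v]; it is trivial
    exactly when [v * fgen x] is itself a representative. *)
Definition sgen (v : F2) (x : X) : F2 := v * fgen x * (srep (v * fgen x))^-1.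

Lemma sgen_in v x : S (sgen v x).
Proof. exact: srep_in. Qed.

Lemma srepM g h : srep (srep g * h) = srep (g * h).
Proof.
by apply/esym/srep_coset; rewrite invgM !mulgA mulgK; apply: srep_in.
Qed.

(** The Schreier generators generate [S], which is therefore contained in the cyclic group of [c].
    The double centraliser [D] of [c] stands in for that group: it is a subgroup containing [c], and
    its elements commute with each other. *)
Lemma sgen_cyclic (c : F2) :
  (forall v x, srep v = v -> sgen v x = 1 \/ sgen v x = c) ->
  forall x y, S x -> S y -> x * y = y * x.
Proof.
move=> cyc.
pose D := [set g : F2 | forall d : F2, commute d c -> commute d g].
have DM g h : D g -> D h -> D (g * h).
  by move=> Dg Dh d dc; apply: commuteM; [apply: Dg | apply: Dh].
have DV g : D g -> D g^-1 by move=> Dg d dc; apply/commuteV/Dg.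
have Dgen v x : srep v = v -> D (sgen v x).
  by move=> /(cyc _ x)[] -> d dc //; apply: commute1.
have Dstep v l : srep v = v -> D (v * fmk [:: l] * (srep (v * fmk [:: l]))^-1).
  case: l => x [] rv; last exact: Dgen.
  (* An inverse letter runs along an edge backwards, so it contributes the inverse of the Schreier
     generator at the other end. *)
  pose v' := srep (v * (fgen x)^-1).
  have <- : (sgen v' x)^-1 = v * fmk [:: (x, true)] * (srep (v * fmk [:: (x, true)]))^-1.
    rewrite /sgen /v' srepM mulgVK rv !invgM invgK fmk_neg.
    by rewrite !mulgA.
  by apply/DV/Dgen/srepK.
have Dw w : D (fmk w * (srep (fmk w))^-1).
  elim/last_ind: w => [|w l IH].
    by rewrite srep1 mulgV => d _; apply: commute1.
  rewrite -cats1 fmk_cat -srepM.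
  have := DM _ _ IH (Dstep _ l (srepK (fmk w))).
  by rewrite -!mulgA mulKg.
have SD x : S x -> D x.
  move=> Sx; have := Dw x; rewrite fmk_word (_ : srep x = 1) ?invg1 ?mulg1 //.
  by rewrite -srep1; apply: srep_coset; rewrite invg1 mulg1.
move=> x y Sx Sy; apply/commute_sym/(SD _ Sx)/commute_sym/(SD _ Sy).
exact: commute_refl.
Qed.

(* The vertices are the cosets S g, represented by [srep]; the non-tree edges freely generate S, and
   [theta] kills all of them but two. *)
Lemma subgroup_onto_F2 :
  (exists x y, [/\ S x, S y & x * y <> y * x]) ->
  exists theta : F2 -> F2,
    (forall x y, S x -> S y -> theta (x * y) = theta x * theta y) /\
    theta @` S = setT.
Proof.
move=> [x0 [y0 [Sx0 Sy0 nab]]].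
have [c1 [v1 [x1 [rv1 e1 n1]]]] : exists c v x, [/\ srep v = v, sgen v x = c & c <> 1].
  apply: contrapT => H; apply: nab; apply: (@sgen_cyclic 1) => // v x rv; left.
  by apply: contrapT => n; apply: H; exists (sgen v x), v, x.
(* Were the first edge the only one with a nontrivial generator, [sgen_cyclic] would make [S]
   commutative. *)
have [v2 [x2 [rv2 n2 ne]]] : exists v x, [/\ srep v = v, sgen v x <> 1 & (v, x) <> (v1, x1)].
  apply: contrapT => H; apply: nab; apply: (@sgen_cyclic c1) => // v x rv.
  apply: contrapT => /not_orP[n n'].
  by apply: H; exists v, x; split=> // -[ev ex]; apply: n'; rewrite ev ex.
have [A [AP AN]] : exists A : faction X F2,
    (forall x g, fstep A (x, false) g = g * fgen x)
    /\ (forall x g, fstep A (x, true) g = g * (fgen x)^-1).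
  have gK x : cancel (fun g : F2 => g * fgen x) (fun g => g * (fgen x)^-1).
    by move=> g; rewrite mulgK.
  have g'K x : cancel (fun g : F2 => g * (fgen x)^-1) (fun g => g * fgen x).
    by move=> g; rewrite mulgVK.
  by exists (bij_action gK g'K).
pose lam (x : X) (g : F2) : F2 :=
  if (srep g, x) == (v1, x1) then fgen false
  else if (srep g, x) == (v2, x2) then fgen true else 1.
have AE (w : F2) g : act A w g = g * w.
  rewrite -{2}[w]fmk_word; elim: (fword w) g => [|l u IH] g; first by rewrite mulg1.
  rewrite /= IH -[l :: u]cat1s fmk_cat mulgA; congr (_ * _).
  by case: l => x []; rewrite ?AP ?AN ?fmk_neg.
have lamS s g x : S s -> lam x (s * g) = lam x g.
  move=> Ss; rewrite /lam (_ : srep (s * g) = srep g) //.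
  by apply: srep_coset; rewrite mulgK.
have cocS s w g : S s -> coc A lam w (s * g) = coc A lam w g.
  move=> Ss; elim: w g => [|[x e] u IH] g //=.
  have E d : fstep A (x, d) (s * g) = s * fstep A (x, d) g.
    by case: d; rewrite ?AP ?AN mulgA.
  by rewrite E IH /cocl; case: e => /=; rewrite ?E lamS.
exists (fun w : F2 => coc A lam w 1); split=> [x y Sx Sy|].
  by rewrite cocM AE mul1g -{2}[x]mulg1 cocS.
have tree v x : lam x v <> 1 -> sgen (srep v) x <> 1.
  rewrite /lam; case: eqP => [[-> ->] _|_]; first by rewrite e1.
  by case: eqP => [[-> ->]|].
(* By [srep_prefix] the path spelling a representative passes through representatives only, so it
   stays in the tree and meets no labelled edge. *)
have path_rep (v : F2) : srep v = v -> coc A lam v 1 = 1.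
  move=> rv; have [u uE] : exists u, u = fword v by exists (fword v).
  have rdv : reduced u by rewrite uE; case: (v).
  rewrite -[v]fmk_word -uE /= reduce_id // in rv *.
  elim/last_ind: u rdv rv {uE} => [|u l IH] rdv rv //.
  have rdu := reduced_rcons rdv.
  have rv' : srep (fmk u) = fmk u.
    by apply: (@srep_prefix (fmk (rcons u l)) _ l rv); rewrite /= reduce_id.
  rewrite -cats1 coc_cat IH // mul1g /= mulg1.
  have -> : act A u 1 = fmk u.
    by have := AE (fmk u) 1; rewrite /= reduce_id // mul1g.
  apply: contrapT; rewrite /cocl; case: l rv {rdv} => x [] /= rv.
    rewrite AN => H; apply: (tree (fmk u * (fgen x)^-1) x).
      by move=> l1; apply: H; rewrite l1 invg1.
    rewrite /sgen srepM mulgVK rv'.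
    rewrite -cats1 fmk_cat fmk_neg in rv.
    by rewrite rv mulgVK mulgV.
  move=> /tree; rewrite rv' /sgen.
  by rewrite -cats1 fmk_cat in rv; rewrite rv mulgV.
have theta_gen v x : srep v = v -> coc A lam (sgen v x) 1 = lam x v.
  move=> rv; rewrite /sgen cocM cocM path_rep // mul1g !AE !mul1g coc_gen.
  set k := srep _; have kk : srep k = k by apply: srepK.
  have -> : v * fgen x = v * fgen x * k^-1 * (act A k 1) by rewrite AE mul1g mulgVK.
  rewrite (cocS (v * fgen x * k^-1) k^-1 (act A k 1) (srep_in _)).
  by rewrite cocV path_rep // invg1 mulg1.
have SVK g : S g -> coc A lam g^-1 1 = (coc A lam g 1)^-1.
  move=> Sg; rewrite -(cocV A lam g) AE mul1g.
  by rewrite -(cocS g g^-1 1 Sg) mulg1.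
have SMK g h : S g -> S h -> coc A lam (g * h) 1 = coc A lam g 1 * coc A lam h 1.
  by move=> Sg Sh; rewrite cocM AE mul1g -(cocS g h 1 Sg) mulg1.
apply/seteqP; split=> // w _; rewrite -[w]fmk_word.
elim: (fword w) => [|l u [g Sg gE]]; first by exists 1.
have [g' Sg' g'E] : exists2 g', S g' & coc A lam g' 1 = fmk [:: l].
  have [g' Sg' g'E] : exists2 g', S g' & coc A lam g' 1 = fgen l.1.
    case: (l.1).
      exists (sgen v2 x2); first exact: sgen_in.
      by rewrite theta_gen // /lam rv2 eqxx; case: eqP.
    exists (sgen v1 x1); first exact: sgen_in.
    by rewrite theta_gen // /lam rv1 eqxx.
  case: l g'E => x [] /= g'E; last by exists g'.
  by exists g'^-1; [apply: SV | rewrite SVK // g'E -fmk_neg].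
by exists (g' * g); [apply: SM | rewrite -cat1s fmk_cat SMK // g'E gE].
Qed.
End Transversal.

(** * A permutation extending a partial isomorphism *)

Section HNN.
Variables (D G : groupType) (A : set D).
Hypothesis sA : subgroup A.

Section Coset.
Variable al : D -> G.
Hypothesis alM : {morph al : x y / x * y}.
Hypothesis al_inj : forall x, A x -> al x = 1 -> x = 1.

Let al1 : al 1 = 1.
Proof. by apply: (mulgI (al 1)); rewrite -alM !mulg1. Qed.
Let alV x : al x^-1 = (al x)^-1.
Proof. by apply/esym/mulg1_eq; rewrite -alM mulgV al1. Qed.

(** A representative of the coset of [g] by the image of [A]. It depends on the coset alone, because
    the set handed to [xget] does. *)
Definition crep (g : G) : G := xget 1 [set h | exists2 x, A x & h = g * al x].

Lemma crep_in g : exists2 x, A x & crep g = g * al x.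
Proof.
have [A1 _ _] := sA.
by have := @xgetPex _ 1 [set h | exists2 x, A x & h = g * al x]; apply; exists g, 1;
  rewrite ?al1 ?mulg1.
Qed.

Lemma crepM g x : A x -> crep (g * al x) = crep g.
Proof.
have [_ AM AV] := sA => Ax; rewrite /crep; congr xget; apply/seteqP; split=> h [y Ay ->].
  by exists (x * y); [apply: AM | rewrite alM mulgA].
by exists (x^-1 * y); [apply: AM => //; apply: AV | rewrite alM alV -mulgA mulVKg].
Qed.

Definition cpart (g : G) : D := xget 1 [set x | A x /\ g = crep g * al x].

Lemma cpartP g : A (cpart g) /\ g = crep g * al (cpart g).
Proof.
have [_ _ AV] := sA; apply: (@xgetPex _ 1 [set x | A x /\ g = crep g * al x]).
have [x Ax e] := crep_in g; exists x^-1; split; first exact: AV.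
by rewrite e alV mulgK.
Qed.

Lemma crepK g : crep (crep g) = crep g.
Proof. by have [x Ax {1}->] := crep_in g; rewrite crepM. Qed.

Lemma cpart_uniq g x : A x -> crep g = g -> cpart (g * al x) = x.
Proof.
have [_ AM AV] := sA => Ax rg; have [Ay] := cpartP (g * al x).
rewrite crepM // rg => /mulgI e; apply: (mulIg x^-1).
rewrite mulgV; apply: al_inj; first by apply: AM => //; apply: AV.
by rewrite alM alV -e mulgV.
Qed.

Definition ctr := {g : G | crep g == g}.
Definition mkctr (g : G) : ctr := exist _ (crep g) (introT eqP (crepK g)).
End Coset.

(* Tensoring with the sequence spaces makes the two coset spaces equipotent, which turns the
   isomorphism between the two subgroups into a permutation, with no cardinality argument. *)
Lemma hnn_permutation (al be : D -> G) :
  {morph al : x y / x * y} -> {morph be : x y / x * y} ->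
  (forall x, A x -> al x = 1 -> x = 1) -> (forall x, A x -> be x = 1 -> x = 1) ->
  exists (S : Type) (s0 : S) (t t' : G * S -> G * S),
    [/\ cancel t t', cancel t' t
      & forall x g s, A x -> t (g * al x, s) = ((t (g, s)).1 * be x, (t (g, s)).2)].
Proof.
move=> alM beM al_inj be_inj.
pose I := ctr al; pose J := ctr be.
pose cons_seq (T : Type) (x : T) (p : nat -> T) n := if n is n'.+1 then p n' else x.
have consK (T : Type) (p : nat -> T) : cons_seq T (p 0%N) (fun n => p n.+1) = p.
  by apply: funext => -[].
(* The coset of the group element is pushed onto the first sequence, a coset for [be] is popped from
   the second, and the component in [A] is kept. Exchanging the roles of the two maps undoes
   this. *)
pose swap (al be : D -> G) (alM : {morph al : x y / x * y})
    (z : G * ((nat -> ctr al) * (nat -> ctr be))) :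
  G * ((nat -> ctr al) * (nat -> ctr be)) :=
  (val (z.2.2 0%N) * be (cpart al z.1),
   (cons_seq _ (mkctr alM z.1) z.2.1, fun n => z.2.2 n.+1)).
pose flip (T U : Type) (z : G * (T * U)) : G * (U * T) := (z.1, (z.2.2, z.2.1)).
have flipK T U : cancel (@flip T U) (@flip U T) by case=> ? [].
exists ((nat -> I) * (nat -> J))%type, (fun=> mkctr alM 1, fun=> mkctr beM 1).
have swapK (al1 be1 : D -> G) (al1M : {morph al1 : x y / x * y}) (be1M : {morph be1 : x y / x * y})
   (be1_inj : forall x, A x -> be1 x = 1 -> x = 1) z :
    flip _ _ (swap be1 al1 be1M (flip _ _ (swap al1 be1 al1M z))) = z.
  case: z => g [p q]; rewrite /flip /swap /=.
  have [Ag gE] := cpartP al1M g.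
  have rq : crep be1 (val (q 0%N)) = val (q 0%N) by apply/eqP/(valP (q 0%N)).
  rewrite cpart_uniq // -gE; congr (_, (_, _)).
  rewrite -[RHS]consK; congr cons_seq; apply: val_inj => /=.
  by rewrite crepM.
exists (swap al be alM), (fun z => flip _ _ (swap be al beM (flip _ _ z))); split.
- by move=> z; apply: swapK.
- by move=> z; rewrite -[LHS]flipK (swapK be al beM alM al_inj) flipK.
move=> x g [p q] Ax; rewrite /swap /= -mulgA -beM.
have [Ag gE] := cpartP alM g; have [_ AM _] := sA.
have rg : crep al (crep al g) = crep al g by apply: crepK.
rewrite {1}gE -mulgA -alM cpart_uniq //; last exact: AM.
congr (_, (_, _)); congr cons_seq; apply: val_inj => /=.
by rewrite crepM.
Qed.
End HNN.

(** * Exponent sums and rewriting *)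

Section Exponent.
Variables (X : choiceType) (x : X).

Definition xsig (l : X * bool) : int := (if l.1 == x then if l.2 then -1 else 1 else 0)%R.

Fixpoint sig (w : seq (X * bool)) : int :=
  if w is l :: w' then (xsig l + sig w')%R else 0%R.

Lemma xsigV l : xsig (invl l) = (- xsig l)%R.
Proof. by case: l => y []; rewrite /xsig /=; case: eqP. Qed.

Lemma sig_cat w w' : sig (w ++ w') = (sig w + sig w')%R.
Proof. by elim: w => [|l w IH] /=; rewrite ?GRing.add0r // IH GRing.addrA. Qed.

Lemma sig_reduce w : sig (reduce w) = sig w.
Proof.
elim: w => [|l w IH] //=; rewrite -IH /cons_red.
case: (reduce w) => [|m w'] //; case: eqP => [->|] //=.
by rewrite xsigV; lia.
Qed.

Lemma sigM (u v : free_group X) : sig (u * v) = (sig u + sig v)%R.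
Proof. by rewrite sig_reduce sig_cat. Qed.

Lemma sigV (u : free_group X) : sig u^-1 = (- sig u)%R.
Proof. by have := sigM u u^-1; rewrite mulgV /=; lia. Qed.

Lemma sigJ (u v : free_group X) : sig (u ^ v) = sig u.
Proof. by rewrite /conjg !sigM sigV; lia. Qed.

Lemma sig_normal_closure (R : set (free_group X)) :
  (forall r, R r -> sig r = 0%R) -> forall n, normal_closure R n -> sig n = 0%R.
Proof.
move=> R0 n; apply: (@normal_closure_min _ R [set n | sig n = 0%R]) => //.
split=> [|u g /= u0]; last by rewrite sigJ.
split=> //= [u v u0 v0|u u0]; rewrite ?sigM ?sigV; lia.
Qed.

Lemma sig_notin w : (forall e, (x, e) \notin w) -> sig w = 0%R.
Proof.
elim: w => [|[y d] w IH] //= H; rewrite IH => [|e]; last first.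
  by have := H e; rewrite inE negb_or => /andP[].
rewrite /xsig /=; case: eqP => // yx; have := H d.
by rewrite yx mem_head.
Qed.

(* The letter (y, i) of the result stands for x^i y x^-i; i is the exponent of x reached so far. *)
Fixpoint rho (i : int) (w : seq (X * bool)) : seq (X * int * bool) :=
  if w is l :: w' then
    if l.1 == x then rho (i + xsig l)%R w' else (l.1, i, l.2) :: rho i w'
  else [::].

Lemma rho_cat i w w' : rho i (w ++ w') = rho i w ++ rho (i + sig w)%R w'.
Proof.
elim: w i => [|l w IH] i /=; first by rewrite GRing.addr0.
rewrite /xsig; case: eqP => [lx|_] /=; rewrite IH ?GRing.add0r //.
by rewrite GRing.addrA.
Qed.

Lemma rho_size i w : (size (rho i w) <= count (fun l => l.1 != x) w)%N.
Proof. by elim: w i => [|l w IH] i //=; case: eqP => //= _; rewrite add1n ltnS. Qed.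

Lemma mem_rho i w (m : X * int * bool) : m \in rho i w -> (m.1.1, m.2) \in w /\ m.1.1 != x.
Proof.
elim: w i => [|l w IH] i //=; case: eqP => [lx|/eqP lx].
  by move=> /IH[mw mx]; rewrite inE mw orbT.
rewrite inE => /orP[/eqP->|/IH[mw mx]] /=; last by rewrite inE mw orbT.
by rewrite -surjective_pairing mem_head.
Qed.

Lemma rho_notin i w : (forall e, (x, e) \notin w) -> rho i w = map (fun l => (l.1, i, l.2)) w.
Proof.
elim: w => [|[y d] w IH] //= H; rewrite IH => [|e]; last first.
  by have := H e; rewrite inE negb_or => /andP[].
case: eqP => // yx; have := H d.
by rewrite yx mem_head.
Qed.

(* In a reduced word a run of powers of x moves the index in a single direction. *)
Lemma rho_head i e w : reduced ((x, e) :: w) ->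
  if rho i ((x, e) :: w) is m :: _ then (if e then m.1.2 < i else i < m.1.2)%R
  else (if e then sig ((x, e) :: w) < 0 else 0 < sig ((x, e) :: w))%R.
Proof.
elim: w i => [|[y d] w IH] i rw.
  by rewrite /= eqxx /= /xsig /= eqxx; case: e {rw}.
have [yx|yx] := eqVneq y x; last first.
  by rewrite /= eqxx (negbTE yx) /xsig /= eqxx; case: e {rw IH} => /=; lia.
move: rw; rewrite yx => /= /andP[ne rw].
have de : d = e by move: ne; rewrite /invl xpair_eqE eqxx /=; case: d e {IH rw} => [] [].
move: rw; rewrite de => rw.
have := IH (i + xsig (x, e))%R rw; rewrite /= eqxx /=.
rewrite /xsig /= eqxx.
by case: (rho _ w) => [|m u]; case: e {IH rw ne de} => /=; lia.
Qed.

(** Neighbours in the result that were separated by a run of [x] have different indices by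
    [rho_head]; neighbours that were adjacent already did not cancel. *)
Lemma rho_reduced i w : reduced w -> reduced (rho i w).
Proof.
elim: w i => [|[y e] w IH] i rw //.
have rw' : reduced w by apply: path_sorted rw.
rewrite /=; case: eqP => [_|/eqP yx]; first exact: IH.
have := IH i rw'; case: w {IH} rw rw' => [|[z d] w] // rw rw'.
have [zx|zx] := eqVneq z x; last first.
  rewrite /= (negbTE zx) /reduced /= => ->; rewrite andbT.
  move: rw => /= /andP[+ _]; apply: contra => /eqP[-> ->]; exact/eqP.
rewrite zx in rw'; have := @rho_head i d w rw'.
rewrite zx; case E : (rho i ((x, d) :: w)) => [|[[m j] c] u] //= lt ru.
rewrite /reduced /= ru andbT; apply/eqP => -[_ ji _].
by move: lt; rewrite ji; case: d {rw rw' E} => /=; lia.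
Qed.

(** By [rho_head] the first run of [x] would either shift the index of the letter after it or, with
    no letter after it, leave a nonzero exponent sum. *)
Lemma rho_const i w : reduced w -> sig w = 0%R ->
  (forall m, m \in rho i w -> m.1.2 = i) -> forall e, (x, e) \notin w.
Proof.
elim: w => [|[y d] w IH] //= rw s0 ci e.
have [yx|yx] := eqVneq y x.
  have := @rho_head i d w; rewrite /= -yx => /(_ rw).
  move: ci; rewrite yx eqxx; case: (rho _ w) => [_|m u ci].
    by move: s0; rewrite yx; case: d {rw}; lia.
  by rewrite (ci m) ?mem_head //; case: d {rw s0 ci}; lia.
rewrite inE negb_or xpair_eqE eq_sym (negbTE yx) /=; apply: IH.
- exact: path_sorted rw.
- by move: s0; rewrite /xsig /= (negbTE yx) GRing.add0r.
- by move=> m mw; apply: ci; rewrite (negbTE yx) inE mw orbT.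
Qed.

End Exponent.

Lemma mem_reduce (X : choiceType) (w : seq (X * bool)) l : l \in reduce w -> l \in w.
Proof.
elim: w => [|m w IH] //=; rewrite /cons_red -/(reduce w).
case E : (reduce w) => [|k u]; first by rewrite !inE => /eqP->; rewrite eqxx.
rewrite E in IH; case: eqP => _ H; rewrite inE.
  by rewrite IH ?orbT // inE H orbT.
by move: H; rewrite inE => /orP[->|/IH->] //; rewrite orbT.
Qed.

Lemma mem_invw (X : choiceType) (w : seq (X * bool)) l : l \in invw w -> invl l \in w.
Proof. by rewrite /invw mem_rev => /mapP[m mw ->]; rewrite invlK. Qed.

Lemma letters_subgroup (X : choiceType) (P : X -> Prop) :
  subgroup [set w : free_group X | forall l, l \in fword w -> P l.1].
Proof.
split=> [l //|u v Pu Pv l /= /mem_reduce|u Pu l /= /mem_reduce /mem_invw /Pu //].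
by rewrite mem_cat => /orP[/Pu|/Pv].
Qed.

Lemma ev_map (X Y : choiceType) (f : X -> Y) (w : seq (X * bool)) :
  ev (fun x => fgen (f x)) w = fmk (map (fun l => (f l.1, l.2)) w).
Proof.
elim: w => [|[x e] w IH] //=; rewrite IH -[_ :: _]cat1s fmk_cat; congr (_ * _).
by rewrite /evl /=; case: e => //; rewrite fmk_neg.
Qed.

Lemma ev_mapK (X Y : choiceType) (f : X -> Y) (g : Y -> X) (w : seq (X * bool)) :
  cancel f g -> ev (fun y => fgen (g y)) (ev (fun x => fgen (f x)) w) = fmk w.
Proof.
move=> fK; rewrite (ev_map f) ev_fmk ev_map -map_comp map_id_in // => -[x e] _.
by rewrite /= fK.
Qed.

Lemma presP (X : choiceType) (R : set (free_group X)) (w : free_group X) :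
  \pi_(presented_group R) w = 1 :> presented_group R <-> normal_closure R w.
Proof.
split=> [e|Nw].
  have /pres_eqP : \pi_(presented_group R) 1 = \pi_(presented_group R) w by rewrite e.
  by rewrite invg1 mul1g.
by apply/esym/pres_eqP; rewrite invg1 mul1g.
Qed.

Lemma pres_pi_morph (X : choiceType) (R : set (free_group X)) (u v : free_group X) :
  \pi_(presented_group R) (u * v) =
  \pi_(presented_group R) u * \pi_(presented_group R) v :> presented_group R.
Proof. by rewrite -[RHS]/(pres_mul _ _) pres_piM. Qed.

Lemma pres_pi_inv (X : choiceType) (R : set (free_group X)) (u : free_group X) :
  \pi_(presented_group R) u^-1 = (\pi_(presented_group R) u)^-1 :> presented_group R.
Proof. by rewrite -[RHS]/(pres_inv _) pres_piV. Qed.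

(** * The HNN extension behind Magnus's rewriting *)

Section Embedding.
Variables (X : choiceType) (x b : X) (s : free_group (X * int)%type) (m M : int).
Hypotheses (m0 : (m <= 0)%R) (M0 : (0 <= M)%R).
Local Notation L := (X * int)%type.
Local Notation Gam := (presented_group [set s]).
Local Notation pis := (\pi_Gam).

(** Only [b] needs a finite window: omitting one extreme letter of [b] already frees the remaining
    letters, so the other generators keep all their indices. *)
Definition in_range (l : L) : Prop := l.1 = b -> (m <= l.2 <= M)%R.
Hypotheses
  (free_top : forall w : free_group L, normal_closure [set s] w ->
     (forall e, ((b, M), e) \notin fword w) -> w = 1)
  (free_bot : forall w : free_group L, normal_closure [set s] w ->
     (forall e, ((b, m), e) \notin fword w) -> w = 1).

Let low (l : L) : Prop := l.1 = b -> (m <= l.2 < M)%R.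
Let A : set (free_group L) := [set w | forall l, l \in fword w -> low l.1].
Let up (l : L) : L := (l.1, (l.2 + 1)%R).
Let down (l : L) : L := (l.1, (l.2 - 1)%R).
Let shift (w : free_group L) : free_group L := ev (fun l => fgen (up l)) w.

Let rm (S : Type) (om : Gam * S) (g : Gam) : Gam * S := (om.1 * g, om.2).

(** Words in low letters avoid ([b], [M]) and their shifts avoid ([b], [m]). By [free_top] and
    [free_bot] both maps to [Gam] are injective on them, as [hnn_permutation] requires. *)
Lemma shift_permutation : exists (S : Type) (s0 : S) (t t' : Gam * S -> Gam * S),
  [/\ cancel t t', cancel t' t
    & forall l om, low l -> t (rm om (pis (fgen l))) = rm (t om) (pis (fgen (up l)))].
Proof.
have piM : {morph (fun w : free_group L => pis w : Gam) : u v / u * v}.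
  exact: pres_pi_morph.
have shM : {morph (fun w : free_group L => pis (shift w) : Gam) : u v / u * v}.
  by move=> u v; rewrite /shift evM piM.
have [||S [s0 [t [t' [tK t'K H]]]]] := @hnn_permutation _ _ A (letters_subgroup _) _ _ piM shM.
- move=> w Aw /presP Nw; apply: free_top => // e.
  by apply/negP => /Aw /(_ erefl) /=; lia.
- move=> w Aw /presP Nw; have upK : cancel up down.
    by case=> y i; rewrite /up /down /=; congr (_, _); lia.
  rewrite -[w]fmk_word -(ev_mapK _ upK) -/(shift w) (free_bot Nw) // => e.
  apply/negP; rewrite /shift ev_map => /mem_reduce /mapP[[[y i] d] /Aw lyi [yb im _]].
  by have := lyi (esym yb); move: im; rewrite /=; lia.
exists S, s0, t, t'; split=> // l [g c] ll.
have := H (fgen l) g c; rewrite /shift ev_gen; apply.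
by move=> k; rewrite inE => /eqP->.
Qed.

Hypothesis bx : b != x.
Variables (r : free_group X).
Hypotheses (r0 : sig x r = 0%R) (rs : rho x 0 r = fword s).
Hypothesis s_range : forall l, l \in fword s -> in_range l.1.

(* <X | r> is an HNN extension, with stable letter x, of the group <L | s> in which x conjugates
   (y, i) to (y, i + 1); its base embeds because the two associated subgroups are free. Here it acts
   on Gam * S, the letter x acting by the permutation t'. *)
Lemma rho_normal_closure (w : free_group X) :
  normal_closure [set r] w -> (forall l, l \in rho x 0 w -> in_range l.1) ->
  normal_closure [set s] (fmk (rho x 0 w)).
Proof.
have [S [s0 [t [t' [tK t'K tE]]]]] := shift_permutation.
pose Om := (Gam * S)%type.
have rmK g : cancel (@rm S ^~ g) (@rm S ^~ g^-1) by case=> h c; rewrite /rm /= mulgK.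
have rmVK g : cancel (@rm S ^~ g^-1) (@rm S ^~ g) by case=> h c; rewrite /rm /= mulgVK.
have rmM (om : Om) g h : rm om (g * h) = rm (rm om g) h by rewrite /rm /= mulgA.
have [B [BP BN]] : exists B : faction X Om,
   (forall y om, fstep B (y, false) om = if y == x then t' om else rm om (pis (fgen (y, 0%R))))
   /\ (forall y om, fstep B (y, true) om = if y == x then t om else rm om (pis (fgen (y, 0%R)))^-1).
  pose g y om := if y == x then t' om else rm om (pis (fgen (y, 0%R))).
  pose g' y om := if y == x then t om else rm om (pis (fgen (y, 0%R)))^-1.
  have gK y : cancel (g y) (g' y) by rewrite /g /g'; case: eqP => _ om //; rewrite ?t'K ?rmK.
  have g'K y : cancel (g' y) (g y) by rewrite /g /g'; case: eqP => _ om //; rewrite ?tK ?rmVK.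
  by exists (bij_action gK g'K).
(* [T i] is the [i]-th power of [t']; [Negz n] is -(n+1), hence the [n.+1] iterates of [t]. *)
pose T (i : int) : Om -> Om := if i is Negz n then iter n.+1 t else iter `|i|%N t'.
have TS i om : T (i + 1)%R om = t' (T i om).
  case: i => [n|[|n]]; first by rewrite /T (_ : (Posz n + 1)%R = Posz n.+1) //=; lia.
    by rewrite /= tK.
  by rewrite (_ : (Negz n.+1 + 1)%R = Negz n) /= ?tK //; lia.
have TP i om : T (i - 1)%R om = t (T i om).
  by rewrite -{2}[i](GRing.subrK 1%R) TS t'K.
have TSr i om : T (i + 1)%R om = T i (t' om).
  case: i => [n|[|n]].
  - by rewrite /T (_ : (Posz n + 1)%R = Posz n.+1) ?absz_nat ?iterSr //; lia.
    by rewrite /= t'K.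
  by rewrite (_ : (Negz n.+1 + 1)%R = Negz n) /T ?iterSr ?t'K //; lia.
have TPr i om : T (i - 1)%R om = T i (t om).
  by rewrite -{2}[i](GRing.subrK 1%R) TSr tK.
have tE' l om : low l -> t' (rm om (pis (fgen (up l)))) = rm (t' om) (pis (fgen l)).
  by move=> ll; rewrite -{1}[om]t'K -tE // tK.
(* Moving a letter past the [i]-th power of the stable letter changes its index from 0 to [i]. As 0
   lies in the window, all intermediate indices do too. *)
have key y i om : in_range (y, i) ->
    rm (T i om) (pis (fgen (y, 0%R))) = T i (rm om (pis (fgen (y, i)))).
  case: i => n; elim: n om => [|n IH] om gi //.
  - rewrite (_ : Posz n.+1 = (Posz n + 1)%R); last by lia.
    have ln : low (y, Posz n) by move=> /gi /=; lia.
    by rewrite !TSr (tE' _ om ln) IH // => /gi /=; lia.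
  - rewrite (_ : Negz 0 = (0 - 1)%R); last by lia.
    have ln : low (y, (0 - 1)%R) by move=> /gi /=; lia.
    by rewrite !TPr (tE _ om ln).
  rewrite (_ : Negz n.+1 = (Negz n - 1)%R); last by lia.
  have ln : low (y, (Negz n - 1)%R) by move=> /gi /=; lia.
  rewrite !TPr (tE _ om ln) /up /= GRing.subrK IH // => /gi /=; lia.
(* The letters [x] accumulate in the exponent of [T], and the others act through the rewritten
   word. *)
have main v i om : (forall l, l \in rho x i v -> in_range l.1) ->
    act B v (T i om) = T (i + sig x v)%R (rm om (pis (fmk (rho x i v)))).
  elim: v i om => [|[y e] v IH] i om /=.
    by rewrite GRing.addr0 => _; case: om => g c; rewrite /rm [pis _](_ : _ = 1) ?mulg1.
  rewrite -/(act B v _) /xsig /=; have [yx|yx] := eqVneq y x => gl.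
    rewrite GRing.addrA; case: e gl => gl.
      by rewrite BN yx eqxx -TP IH.
    by rewrite BP yx eqxx -TS IH.
  rewrite GRing.add0r -[_ :: rho _ _ _]cat1s fmk_cat.
  rewrite pres_pi_morph rmM.
  rewrite -IH; last by move=> l lv; apply: gl; rewrite inE lv orbT.
  have gy : in_range (y, i) by apply: (gl (y, i, e)); rewrite mem_head.
  congr (act B v _); case: e {gl}; rewrite ?BN ?BP (negbTE yx) ?key //.
  rewrite fmk_neg pres_pi_inv.
  by rewrite -{1}[om](rmVK (pis (fgen (y, i)))) -key // rmK.
have rB om : act B r om = om.
  have := main r 0%R om; rewrite rs r0 /= => -> //.
  rewrite (_ : fmk _ = s) ?fmk_word // (_ : pis s = 1) /rm ?mulg1; first by case: om.
  by apply/presP; exact (normal_closure_sub (erefl s)).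
(* Since [w] fixes the point (1, [s0]) and has exponent sum 0, right multiplication by the rewritten
   word fixes 1 in [Gam]. *)
move=> Nw gw; have := main w 0%R (1, s0) gw.
have rA u om : [set r] u -> act B u om = om by move=> ->.
rewrite (act_normal_closure rA _ Nw) (sig_normal_closure (R := [set r]) _ Nw); last by move=> u ->.
by move=> [/esym]; rewrite mul1g => /presP.
Qed.
End Embedding.

(** * Cyclically reduced words *)

Definition creduced (X : choiceType) (w : seq (X * bool)) : bool :=
  path.cycle (fun l m => m != invl l) w.

Lemma creduced_reduced (X : choiceType) (w : seq (X * bool)) : creduced w -> reduced w.
Proof. by case: w => [|l w] //; rewrite /creduced /= rcons_path => /andP[]. Qed.

Lemma creduced_cyc_reduce (X : choiceType) (w : seq (X * bool)) :
  reduced w -> creduced (cyc_reduce w).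
Proof.
move=> rw; have [[p wE] lastP] := cyc_reduceP rw.
have : reduced (cyc_reduce w).
  by move: rw; rewrite {1}wE => /cat_sorted2[_ /cat_sorted2[]].
case: (cyc_reduce w) lastP => [|l s] // H; rewrite /creduced /= rcons_path => ->.
by apply/negP => /eqP e; apply: (H l s erefl); rewrite [in RHS]e invlK.
Qed.

Lemma fmk_id (X : choiceType) (w : seq (X * bool)) : reduced w -> fword (fmk w) = w.
Proof. exact: reduce_id. Qed.

Definition conjugate (G : groupType) (x y : G) : Prop := exists g, y = x ^ g.

Lemma conjugate_rot (X : choiceType) (w : seq (X * bool)) k :
  conjugate (fmk w) (fmk (rot k w)).
Proof.
exists (fmk (take k w)); rewrite -{2}(cat_take_drop k w) /rot !fmk_cat.
by rewrite /conjg -mulgA mulKg.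
Qed.

Lemma conjugate_cyc_reduce (X : choiceType) (u : free_group X) :
  conjugate u (fmk (cyc_reduce u)).
Proof.
have ru : reduced u by case: u.
have [[p uE] _] := cyc_reduceP ru.
exists (fmk p); rewrite -[in RHS](fmk_word u) [in RHS]uE !fmk_cat fmk_invw.
by rewrite /conjg -!mulgA mulVg mulg1 mulKg.
Qed.

Lemma conjugate_trans (G : groupType) (x y z : G) :
  conjugate x y -> conjugate y z -> conjugate x z.
Proof. by move=> [g ->] [h ->]; exists (g * h); rewrite conjgM. Qed.

Lemma conjugate_sym (G : groupType) (x y : G) : conjugate x y -> conjugate y x.
Proof. by move=> [g ->]; exists g^-1; rewrite -conjgM mulgV conjg1. Qed.

Lemma conjugate_normal_closure (G : groupType) (x y z : G) :
  conjugate x y -> normal_closure [set x] z -> normal_closure [set y] z.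
Proof.
move=> /conjugate_sym[g ->]; apply: normal_closure_min; first exact: normal_closure_normal.
move=> _ ->; have [_ nJ] := normal_closure_normal [set y].
by apply: nJ; exact (normal_closure_sub (erefl y)).
Qed.

Section CountReduce.
Variables (X : choiceType) (P : pred X).
Local Notation cnt := (count (fun l : X * bool => P l.1)).

Lemma count_reduce w : (cnt (reduce w) <= cnt w)%N.
Proof.
elim: w => [|l w IH] //=; apply: (leq_trans _ (leq_add (leqnn (P l.1)) IH)).
rewrite /cons_red -/(reduce w); case: (reduce w) => [|m u] //=.
by case: eqP => //= _; rewrite addnA leq_addl.
Qed.

Lemma count_invw w : cnt (invw w) = cnt w.
Proof. by rewrite /invw count_rev count_map; apply: eq_count. Qed.

Lemma count_mulg (u v : free_group X) : (cnt (fword (u * v)%g) <= cnt u + cnt v)%N.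
Proof. by rewrite -count_cat; apply: count_reduce. Qed.

Lemma count_invg (u : free_group X) : (cnt (fword u^-1%g) <= cnt u)%N.
Proof. by rewrite -[leqRHS]count_invw; apply: count_reduce. Qed.

Lemma count_ev (Y : choiceType) (h : Y -> free_group X) (Q : pred Y) w :
  (forall y, (cnt (fword (h y)) <= Q y)%N) ->
  (cnt (fword (ev h w)) <= count (fun l => Q l.1) w)%N.
Proof.
move=> H; elim: w => [|[y e] w IH] //=; apply: (leq_trans (count_mulg _ _)).
apply: leq_add => //; rewrite /evl; case: e => //=.
exact: (leq_trans (count_invg _)).
Qed.
End CountReduce.

Definition gpow (X : choiceType) (t : X) (k : int) : free_group X :=
  fmk (nseq `|k|%N (t, (k < 0)%R)).

Lemma sig_gpow (X : choiceType) (t x : X) (k : int) :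
  sig x (gpow t k) = (if t == x then k else 0)%R.
Proof.
have H n e : sig x (nseq n (t, e)) = (if t == x then if e then - n%:Z else n%:Z else 0)%R.
  elim: n => [|n IH] /=; first by case: eqP; case: e.
  by rewrite IH /xsig /=; case: eqP => _; case: e {IH} => //; lia.
by rewrite /gpow /= sig_reduce H; case: eqP => // _; case: ifP; lia.
Qed.

Lemma seq_extrema (i0 : int) (s : seq int) : exists m M : int,
  [/\ m \in i0 :: s, M \in i0 :: s & forall i, i \in i0 :: s -> (m <= i <= M)%R].
Proof.
elim: s => [|j s [m [M [ms Ms H]]]].
  by exists i0, i0; rewrite mem_head; split=> // i; rewrite inE => /eqP->; lia.
exists (if j < m then j else m)%R, (if M < j then j else M)%R.
move: ms Ms; rewrite !inE => ms Ms; split.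
- by case: ifP => _; rewrite ?eqxx ?orbT //; move: ms => /orP[->|->]; rewrite ?orbT.
- by case: ifP => _; rewrite ?eqxx ?orbT //; move: Ms => /orP[->|->]; rewrite ?orbT.
move=> i; rewrite !inE => ii; have [->|ij] := eqVneq i j.
  by case: ifP; case: ifP; lia.
have := H i; rewrite inE; move: ii; rewrite (negbTE ij) /= => -> /(_ isT).
by case: ifP; case: ifP; lia.
Qed.

Section Step.
Variables (X : choiceType) (x : X) (l0 : X * bool) (w0 : seq (X * bool)).
Hypotheses (l0x : l0.1 != x) (rC : creduced (l0 :: w0)) (rS : sig x (l0 :: w0) = 0%R).
Local Notation s := (fmk (rho x 0 (l0 :: w0))).

(** Cyclic reducedness is reducedness of the word followed by its first letter. As the exponent sum
    of [x] vanishes, this extra letter has index 0 again. *)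
Lemma rho_creduced : creduced (rho x 0 (l0 :: w0)).
Proof.
have : reduced (rho x 0 (rcons (l0 :: w0) l0)) by apply: rho_reduced.
rewrite -cats1 rho_cat rS GRing.addr0 [rho x 0 [:: l0]]/= (negbTE l0x).
by rewrite /= (negbTE l0x) cats1.
Qed.

Lemma word_step : fword s = rho x 0 (l0 :: w0).
Proof. exact/fmk_id/creduced_reduced/rho_creduced. Qed.

(** The window is the span of the indices of [l0.1] in [s]. Its two extreme letters occur in [s], so
    the assumed Freiheitssatz gives the freeness needed at both ends. *)
Lemma rho_step :
  (forall y e w, (y, e) \in fword s -> normal_closure [set s] w ->
    (forall d, (y, d) \notin fword w) -> w = 1) ->
  exists m M : int,
    [/\ (m <= 0 <= M)%R, exists e, (l0.1, m, e) \in fword s,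
        exists e, (l0.1, M, e) \in fword s,
        forall l, l \in fword s -> in_range l0.1 m M l.1
      & forall w, normal_closure [set fmk (l0 :: w0)] w ->
          (forall l, l \in rho x 0 w -> in_range l0.1 m M l.1) ->
          normal_closure [set s] (fmk (rho x 0 w))].
Proof.
move=> FR; pose J := [seq l.1.2 | l <- fword s & l.1.1 == l0.1].
have [m [M [mJ MJ H]]] := seq_extrema 0%R J.
have occ i : i \in 0%R :: J -> exists e, (l0.1, i, e) \in fword s.
  rewrite inE => /orP[/eqP->|/mapP[[[y j] e]]].
    by exists l0.2; rewrite word_step /= (negbTE l0x) mem_head.
  by rewrite mem_filter /= => /andP[/eqP -> ys ->]; exists e.
have s_range l : l \in fword s -> in_range l0.1 m M l.1.
  move=> ls ly; apply: H; rewrite inE; apply/orP; right.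
  by apply/mapP; exists l; rewrite // mem_filter ly eqxx.
have m0M : (m <= 0 <= M)%R by apply: H; rewrite mem_head.
exists m, M; split=> //; [exact: occ | exact: occ | move=> w].
have [m0 M0] := andP m0M; have [e1 b1] := occ m mJ; have [e2 b2] := occ M MJ.
have rw : fword (fmk (l0 :: w0)) = l0 :: w0 by apply/fmk_id/creduced_reduced.
apply: (@rho_normal_closure X x l0.1 s m M m0 M0) => //.
- by move=> u Nu; apply: FR b2 Nu.
- by move=> u Nu; apply: FR b1 Nu.
- by rewrite rw.
by rewrite rw word_step.
Qed.
End Step.

(** * The Freiheitssatz *)

Section ExpandLetter.
Variables (X : choiceType) (t : X) (n : nat).
Hypothesis n_gt0 : (0 < n)%N.

Definition expand (w : seq (X * bool)) : seq (X * bool) :=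
  flatten [seq (if l.1 == t then nseq n l else [:: l]) | l <- w].

Lemma expand_reduced w : reduced w -> reduced (expand w) /\ ohead (expand w) = ohead w.
Proof.
elim: w => [|l w IH] // rw; have [ru hu] := IH (path_sorted rw).
rewrite /expand /= -/(expand w).
have rl : reduced (l :: expand w).
  move: hu ru rw; rewrite /reduced /=; case: (expand w) => [|m u] //= + ->.
  by case: w {IH} => [|k w] //= [->] /andP[-> _].
case: eqP => _; last by split.
case: n n_gt0 => // k _; elim: k => [|k [IHk _]]; first by split.
by split=> //; move: IHk; rewrite /reduced /= => ->; rewrite invl_neq.
Qed.

Lemma ev_expand (h : X -> free_group X) w :
  h t = fgen t ^+ n -> (forall l, l \in w -> l.1 != t -> h l.1 = fgen l.1) ->
  ev h w = fmk (expand w).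
Proof.
move=> ht; elim: w => [|[y e] w IH] //= H.
rewrite IH => [|l lw]; last by apply: H; rewrite inE lw orbT.
rewrite /expand /= -/(expand w) fmk_cat; congr (_ * _); rewrite /evl /=.
case: eqP => [->|/eqP yt]; last first.
  by have := H (y, e); rewrite mem_head /= => -> //; case: e {H}; rewrite ?fmk_neg.
rewrite ht; have hn d k : fmk (nseq k (t, d)) = fmk [:: (t, d)] ^+ k.
  elim: k => [|k IHk] //.
  by rewrite expgS -IHk -fmk_cat.
by case: e {H}; rewrite hn // fmk_neg expVgn.
Qed.
End ExpandLetter.

Lemma trivial_normal (G : groupType) : normal_subgroup [set 1 : G].
Proof.
split; first by split=> // [x y -> ->|x ->]; rewrite ?mulg1 ?invg1.
by move=> x g ->; rewrite conj1g.
Qed.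

Lemma rho_const_nil (X : choiceType) (x : X) (w : free_group X) :
  sig x w = 0%R -> rho x 0 w = [::] -> w = 1.
Proof.
move=> s0 wE; have rw : reduced w by case: w {s0 wE}.
have xw : forall e, (x, e) \notin fword w by apply: (@rho_const _ x 0%R) => //; rewrite wE.
by apply: free_word_eq; move: wE; rewrite rho_notin //; case: (fword w).
Qed.

Lemma fmk_eq1 (X : choiceType) (w : seq (X * bool)) : reduced w -> fmk w = 1 -> w = [::].
Proof. by move=> rw /(congr1 (@fword X)); rewrite fmk_id. Qed.

(** Equivalently, for each generator occurring in [r], the other generators freely generate a
    subgroup of the quotient by [r]. *)
Definition freiheitssatz_at (X : choiceType) (r : free_group X) : Prop :=
  forall x e w, (x, e) \in fword r -> normal_closure [set r] w ->
    (forall d, (x, d) \notin fword w) -> w = 1.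

Section Induction.
Variable n : nat.
Hypothesis IH : forall (X : choiceType) (r : free_group X),
  (size r < n)%N -> creduced r -> freiheitssatz_at r.

Section Case.
Variables (X : choiceType) (r : free_group X) (x : X) (e : bool) (w : free_group X).
Hypotheses (rn : (size r <= n)%N) (rC : creduced r) (xr : (x, e) \in fword r)
  (Nw : normal_closure [set r] w) (xw : forall d, (x, d) \notin fword w).

(* Magnus's rewriting with stable letter x: the letters of w get index 0, while some letter of the
   shorter relator s has another index. *)
Lemma freiheitssatz_zero : sig x r = 0%R -> w = 1.
Proof.
move=> r0; have rr := creduced_reduced rC.
have [l0 l0r l0x] : exists2 l, l \in fword r & l.1 != x.
  apply: contrapT => H.
  have rho0 : rho x 0 r = [::].
    case E : (rho x 0 r) => [|m u] //; exfalso; apply: H.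
    have : m \in rho x 0 r by rewrite E mem_head.
    by move=> /mem_rho[mr mx]; exists (m.1.1, m.2).
  by move: xr; rewrite (rho_const_nil r0 rho0).
pose i := index l0 r; pose w0 := drop i.+1 r ++ take i r.
have rE : rot i r = l0 :: w0 by apply: rot_index.
have mem_rE : l0 :: w0 =i fword r by move=> l; rewrite -rE mem_rot.
have C0 : creduced (l0 :: w0) by rewrite -rE /creduced rot_cycle.
have S0 : sig x (l0 :: w0) = 0%R.
  rewrite -rE /rot sig_cat GRing.addrC -sig_cat cat_take_drop //.
have sE := word_step l0x C0 S0.
(* The rewriting erases the letters [x], and there is at least one. *)
have sn : (size (fmk (rho x 0 (l0 :: w0))) < n)%N.
  rewrite sE; apply: leq_ltn_trans (rho_size _ _ _) _.
  have /seq.permP <- : perm_eq (fword r) (l0 :: w0) by rewrite -rE perm_sym perm_rot.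
  apply: leq_trans rn.
  rewrite -(count_predC (fun l => l.1 != x) r) -[X in (X < _)%N]addn0 ltn_add2l.
  by rewrite -has_count; apply/hasP; exists (x, e); rewrite //= eqxx.
have FR := IH sn (_ : creduced _); rewrite sE in FR.
have {}FR := FR (rho_creduced l0x C0 S0).
have [m [M [m0M _ _ _ KP]]] := rho_step l0x C0 S0 FR.
have wE : rho x 0 w = [seq (l.1, 0%R, l.2) | l <- fword w] by apply: rho_notin.
have Ns : normal_closure [set fmk (rho x 0 (l0 :: w0))] (fmk (rho x 0 w)).
  apply: KP; last by rewrite wE => l /mapP[k _ ->] _.
  by apply: conjugate_normal_closure Nw; rewrite -rE -{1}[r]fmk_word; apply: conjugate_rot.
(* Were all indices 0, [rho_const] would leave no [x] in the relator. *)
have [k ks k0] : exists2 k, k \in rho x 0 (l0 :: w0) & k.1.2 != 0%R.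
  apply: contrapT => H.
  suff /(_ e) : forall d, (x, d) \notin l0 :: w0 by rewrite mem_rE xr.
  apply: (@rho_const _ x 0%R (l0 :: w0) (creduced_reduced C0) S0) => k ks.
  by apply: contrapT => /eqP k0; apply: H; exists k.
have rw : reduced w by case: (w).
have: fmk (rho x 0 w) = 1.
  apply: (FR k.1 k.2) => //; first by rewrite sE -surjective_pairing.
  move=> d; rewrite fmk_id ?rho_reduced // wE; apply/mapP => -[l _ kE].
  by move: k0; rewrite (_ : k.1.2 = 0%R) //; case: kE => ->.
move=> /fmk_eq1 -/(_ (rho_reduced _ _ rw)); rewrite wE => H.
by apply: free_word_eq; case: (fword w) H.
Qed.

(* The substitution t -> t^|n|, x -> x t^(-sgn(n) tau), where n and tau are the exponent sums of x
   and t in r, keeps the other generators free and makes the exponent sum of t vanish. *)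
Lemma freiheitssatz_nonzero : sig x r <> 0%R -> w = 1.
Proof.
move=> rx; have rr := creduced_reduced rC; have rw : reduced w by case: (w).
have xl l : l \in fword w -> l.1 != x.
  by move=> lw; apply/eqP => lx; have := xw l.2; rewrite -lx -surjective_pairing lw.
have [[l0 l0r tx]|H] := pselect (exists2 l, l \in fword r & l.1 != x); last first.
  (* Here [r] involves [x] alone: killing [x] kills [r] but leaves [w] unchanged. *)
  pose f y : free_group X := if y == x then 1 else fgen y.
  have : ev f w = 1.
    apply: (ev_normal_closure (@trivial_normal _) _ Nw) => _ -> /=.
    elim: (fword r) H => [|l u IHu] // H /=; rewrite IHu; last first.
      by move=> [m mu mx]; apply: H; exists m; rewrite // inE mu orbT.
    rewrite /evl /f mulg1; case: eqP => [_|/eqP lx]; first by rewrite invg1 if_same.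
    by exfalso; apply: H; exists l; rewrite // mem_head.
  rewrite (@eq_ev _ _ f (@fgen X)) ?ev_fgen ?fmk_word // => l /xl lx.
  by rewrite /f (negbTE lx).
set t := l0.1 in tx; pose p := `|sig x r|%N.
pose tau := (if sig x r < 0 then sig t r else - sig t r)%R.
have p_gt0 : (0 < p)%N by rewrite /p; lia.
pose f y : free_group X :=
  if y == t then fgen t ^+ p else if y == x then fgen x * gpow t tau else fgen y.
have xt : x != t by rewrite eq_sym.
have sig_t v : sig t (ev f v) = (p%:Z * sig t v + tau * sig x v)%R.
  have sX k : sig t (fgen t ^+ k) = Posz k.
    by elim: k => [|k IHk] //; rewrite expgS sigM IHk /= /xsig /= eqxx; lia.
  have sf y : sig t (f y) = (p%:Z * xsig t (y, false) + tau * xsig x (y, false))%R.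
    rewrite /f /xsig /=; have [->|yt] := eqVneq y t; first by rewrite sX (negbTE tx); lia.
    have [yx|yx] := eqVneq y x; last by rewrite /= /xsig /= (negbTE yt); lia.
    by rewrite sigM sig_gpow eqxx /= /xsig /= (negbTE xt); lia.
  elim: v => [|[y d] v IHv]; first by rewrite /=; lia.
  rewrite [ev _ _]/= sigM IHv [sig t (_ :: _)]/= [sig x (_ :: _)]/= /evl.
  case: d => /=; rewrite ?sigV sf /xsig /=; case: eqP => _; case: eqP => _; lia.
have sig_x v : sig x (ev f v) = sig x v.
  have sX k : sig x (fgen t ^+ k) = 0%R.
    by elim: k => [|k IHk] //; rewrite expgS sigM IHk /= /xsig /= (negbTE tx).
  have sf y : sig x (f y) = xsig x (y, false).
    rewrite /f; have [->|yt] := eqVneq y t; first by rewrite sX /xsig /= (negbTE tx).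
    have [yx|yx] := eqVneq y x; last by rewrite /= GRing.addr0.
    by rewrite yx sigM sig_gpow (negbTE tx) /= !GRing.addr0.
  elim: v => [|[y d] v IHv] //; rewrite [ev _ _]/= sigM IHv [sig x (_ :: _)]/=.
  by rewrite /evl; case: d => /=; rewrite ?sigV sf /xsig /=; case: eqP.
(* Letters other than [t] do not multiply, and rewriting with stable letter [t] erases the rest.
   Since [r] contains [t], the new relator will be shorter than [r]. *)
have cnt_f y : (count (fun l => l.1 != t) (fword (f y)) <= (y != t))%N.
  rewrite /f; have [yt|yt] := eqVneq y t.
    elim: (p) => [|k IHk] //; rewrite expgS.
    apply: (leq_trans (count_mulg (fun y => y != t) _ _)).
    by rewrite /= eqxx.
  case: eqP => _; last by rewrite /= yt.
  apply: (leq_trans (count_mulg (fun y => y != t) _ _)).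
  have /eqP-> : count (fun l => l.1 != t) (fword (gpow t tau)) == 0%N.
    rewrite -leqn0; apply: leq_trans (count_reduce (fun y => y != t) _) _.
    by rewrite count_nseq /= eqxx.
  by rewrite /= xt.
pose c := cyc_reduce (fword (ev f r)).
have rfr : reduced (fword (ev f r)) by case: (ev f r).
have cC : creduced c by apply: creduced_cyc_reduce.
have conj_c : conjugate (ev f r) (fmk c) by apply: conjugate_cyc_reduce.
have sig_c y : sig y c = sig y (ev f r).
  have [[q cE] _] := cyc_reduceP rfr.
  have [g /(congr1 (fun z : free_group X => sig y z))] := conj_c.
  by rewrite sigJ fmk_id ?creduced_reduced.
(* The substitution preserves the nonzero exponent sum of [x], so [x] survives cyclic reduction and
   can be rotated to the front. *)
have [d xc] : exists d, (x, d) \in c.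
  apply: contrapT => H; apply: rx; rewrite -sig_x -sig_c sig_notin // => d.
  by apply/negP => xc; apply: H; exists d.
pose i := index (x, d) c; pose w0 := drop i.+1 c ++ take i c.
have cE : rot i c = (x, d) :: w0 by apply: rot_index.
have C0 : creduced ((x, d) :: w0) by rewrite -cE /creduced rot_cycle.
have S0 : sig t ((x, d) :: w0) = 0%R.
  rewrite -cE /rot sig_cat GRing.addrC -sig_cat cat_take_drop sig_c sig_t.
  by rewrite /p /tau; case: ifP; lia.
have sE := @word_step _ t (x, d) w0 xt C0 S0.
have sn : (size (fmk (rho t 0 ((x, d) :: w0))) < n)%N.
  rewrite sE; apply: leq_ltn_trans (rho_size _ _ _) _.
  have /seq.permP <- : perm_eq c ((x, d) :: w0) by rewrite -cE perm_sym perm_rot.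
  apply: leq_trans rn.
  apply: (@leq_ltn_trans (count (fun l => l.1 != t) (fword (ev f r)))).
    have [[q qE] _] := cyc_reduceP rfr.
    by rewrite [X in (_ <= count _ X)%N]qE !count_cat -/c addnCA leq_addr.
  apply: leq_ltn_trans (count_ev (P := fun y => y != t) r cnt_f) _.
  rewrite -(count_predC (fun l => l.1 != t) r) -[X in (X < _)%N]addn0 ltn_add2l.
  by rewrite -has_count; apply/hasP; exists l0; rewrite //= eqxx.
have FR := IH sn (_ : creduced _); rewrite sE in FR.
have {}FR := FR (@rho_creduced _ t (x, d) w0 xt C0 S0).
have [m [M [m0M _ [d' xM] _ KP]]] := @rho_step _ t (x, d) w0 xt C0 S0 FR.
have fw : ev f w = fmk (expand t p w).
  apply: ev_expand => [|l lw lt]; first by rewrite /f eqxx.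
  by rewrite /f (negbTE lt) (negbTE (xl _ lw)).
have [rew hew] := expand_reduced t p_gt0 rw.
have xfw l : l \in fword (ev f w) -> l.1 != x.
  rewrite fw => /mem_reduce /flatten_mapP[k /xl kx].
  by case: ifP => _; rewrite ?mem_nseq ?inE; [move=> /andP[_ /eqP->] | move=> /eqP->].
have Nfw : normal_closure [set fmk ((x, d) :: w0)] (ev f w).
  apply: (ev_normal_closure (normal_closure_normal _) _ Nw) => _ ->.
  apply: (@conjugate_normal_closure _ (ev f r)); last by exact (normal_closure_sub (erefl _)).
  by apply: conjugate_trans conj_c _; rewrite -cE; apply: conjugate_rot.
have rfw : reduced (fword (ev f w)) by case: (ev f w).
have Ns : normal_closure [set fmk (rho t 0 ((x, d) :: w0))] (fmk (rho t 0 (ev f w))).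
  by apply: KP => // l /mem_rho[/xfw + _] lx; rewrite lx eqxx.
(* The rewritten word has no letter over [x] at any index, whereas ([x], [M]) occurs in the shorter
   relator. *)
have: fmk (rho t 0 (ev f w)) = 1.
  apply: (FR _ d' _ xM Ns).
  by move=> d1; rewrite fmk_id ?rho_reduced //; apply/negP => /mem_rho[/xfw]; rewrite eqxx.
move=> /fmk_eq1 -/(_ (rho_reduced _ _ rfw)) /rho_const_nil.
have -> : sig t (ev f w) = 0%R.
  apply: (sig_normal_closure (R := [set fmk ((x, d) :: w0)]) _ Nfw) => _ ->.
  by rewrite fmk_id // creduced_reduced.
move=> /(_ erefl); rewrite fw => /fmk_eq1 -/(_ rew) ew.
by apply: free_word_eq; move: hew; rewrite ew; case: (fword w).
Qed.
End Case.
End Induction.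

(** Induction on the length of [r] over all alphabets at once, because rewriting changes the
    alphabet. *)
Theorem freiheitssatz (X : choiceType) (r : free_group X) : creduced r -> freiheitssatz_at r.
Proof.
have [n] := ubnP (size r); elim: n X r => // n IHn X r; rewrite ltnS => rn rC x e w xr Nw xw.
have IH' : forall (Y : choiceType) (u : free_group Y),
    (size u < n)%N -> creduced u -> freiheitssatz_at u.
  by move=> Y u; apply: IHn.
have [r0|/eqP r0] := eqVneq (sig x r) 0%R.
  exact: (freiheitssatz_zero IH' rn rC xr Nw xw r0).
exact: (freiheitssatz_nonzero IH' rn rC xr Nw xw r0).
Qed.

(** * Conjugacy of cyclically reduced words *)

Lemma fmk_eq (X : choiceType) (w w' : seq (X * bool)) :
  reduced w -> reduced w' -> fmk w = fmk w' -> w = w'.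
Proof. by move=> rw rw' /(congr1 (@fword X)); rewrite !fmk_id. Qed.

Lemma sorted_cat2 (T : Type) (e : rel T) (x y : T) (s t : seq T) :
  sorted e (rcons s x) -> sorted e (y :: t) -> e x y -> sorted e (rcons s x ++ y :: t).
Proof.
case: s => [|z s] /=; first by move=> _ -> ->.
by rewrite cat_path last_rcons /= => -> -> ->.
Qed.

(** Induction on the conjugator. If [c] begins with its first letter [l] or ends with the inverse of
    [l], conjugating by [l] rotates [c]. Otherwise the conjugate is reduced as written, and its
    outer letters are inverse to each other, against cyclic reducedness. *)
Lemma conjugate_creduced (X : choiceType) (c c' : seq (X * bool)) :
  creduced c -> creduced c' -> conjugate (fmk c) (fmk c') -> cyclic_conjugate c' c.
Proof.
move=> + C' [g gE]; have rg : reduced g by case: (g).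
move: gE; rewrite -[g]fmk_word; have {g rg} [g rg ->] : exists2 u, reduced u & fword g = u.
  by exists g.
elim: g c rg => [|l g IH] c rg cE C.
  exists 0%N; rewrite rot0; apply: fmk_eq (creduced_reduced C') (creduced_reduced C) _.
  by rewrite cE conjg1.
have gM : fmk (l :: g) = fmk [:: l] * fmk g by rewrite -fmk_cat.
have lV : fmk [:: invl l] = (fmk [:: l])^-1 by rewrite -fmk_invw.
have rg' : reduced g by apply: path_sorted rg.
have step k : fmk (rot k c) = fmk c ^ fmk [:: l] -> cyclic_conjugate c' c.
  rewrite gM conjgM in cE => cl; rewrite -cl in cE.
  have [|j ->] := IH _ rg' cE; first by rewrite /creduced rot_cycle.
  by exists (rot_add c k j); rewrite rot_rot_add.
have [c0|c_n0] := eqVneq c [::].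
  by apply: (step 0%N); rewrite rot0 c0 conj1g.
have [ch|ch] := eqVneq (ohead c) (Some l).
  apply: (step 1%N); case: c {IH cE C step c_n0} ch => [|m d] //= [->].
  by rewrite rot1_cons -cats1 fmk_cat -[l :: d]cat1s fmk_cat /conjg -mulgA mulKg.
case/lastP: c => [|d m] // in cE C c_n0 ch step *.
have [mE|ml] := eqVneq m (invl l).
  apply: (step (size d)); rewrite -cats1 rot_size_cat mE !fmk_cat lV /conjg.
  by rewrite mulgVK.
exfalso.
have rdm := creduced_reduced C.
have rdg : reduced (rcons d m ++ l :: g).
  by apply: sorted_cat2 => //; rewrite -[l]invlK (inj_eq (can_inj (@invlK _))) eq_sym.
have rall : reduced (invw (l :: g) ++ rcons d m ++ l :: g).
  move: rdg ch (invw_reduced rg); rewrite /invw /= rev_cons.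
  case E : (rcons d m) => [|h u] /=; first by have := size_rcons d m; rewrite E.
  move=> r1 hl r2; apply: sorted_cat2 => //.
  by rewrite invlK; apply: contra hl => /eqP->.
have c'E : c' = invw (l :: g) ++ rcons d m ++ l :: g.
  apply: fmk_eq (creduced_reduced C') rall _.
  by rewrite cE !fmk_cat fmk_invw /conjg.
move: C'; rewrite c'E; case/lastP E : (l :: g) => [|g' z] //.
rewrite /invw map_rcons rev_rcons /creduced /= rcons_path => /andP[_].
by rewrite !last_cat last_rcons eqxx.
Qed.

Lemma conjugate_cyclic (X : choiceType) (u v : free_group X) :
  conjugate u v -> cyclic_conjugate (cyc_reduce (fword u)) (cyc_reduce (fword v)).
Proof.
move=> uv; have ru : reduced u by case: (u). have rv : reduced v by case: (v).
apply: conjugate_creduced; try exact: creduced_cyc_reduce.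
apply: conjugate_trans (conjugate_cyc_reduce u).
exact/conjugate_sym/(conjugate_trans uv)/conjugate_cyc_reduce.
Qed.

(** * Relators whose normal closure contains [a, b] *)

Lemma normal_closure1 (G : groupType) (z : G) : normal_closure [set 1 : G] z -> z = 1.
Proof. by apply: (normal_closure_min (@trivial_normal G)). Qed.

Lemma sig_dvd_normal_closure (X : choiceType) (x : X) (r n : free_group X) :
  normal_closure [set r] n -> (sig x r %| sig x n)%Z.
Proof.
apply: (@normal_closure_min _ [set r] [set n : free_group X | (sig x r %| sig x n)%Z]).
  split=> [|u g /=]; last by rewrite sigJ.
  split=> /= [|u v|u]; first by rewrite dvdz0.
    by rewrite sigM; apply: GRing.rpredD.
  by rewrite sigV GRing.rpredN.
by move=> _ ->; apply: dvdzz.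
Qed.

Lemma reduced_nseq (X : choiceType) (x : X) e (w : seq (X * bool)) :
  reduced ((x, e) :: w) -> (forall l, l \in w -> l.1 = x) -> w = nseq (size w) (x, e).
Proof.
elim: w e => [|[y d] w IH] e //= /andP[ne rw] H.
have yx : y = x by apply: (H (y, d)); rewrite mem_head.
move: rw ne; rewrite yx /invl xpair_eqE eqxx /= => rw ne.
have de : d = e by case: d e ne {IH rw H} => [] [].
rewrite de in rw *; congr (_ :: _); apply: IH => // l lw.
by apply: H; rewrite inE lw orbT.
Qed.

Lemma sig_nseq (X : choiceType) (x : X) e n :
  sig x (nseq n (x, e)) = (if e then - Posz n else Posz n)%R.
Proof.
elim: n => [|n IH] /=; first by case: e.
by rewrite IH /xsig /= eqxx; case: e {IH} => //; lia.
Qed.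

Lemma gpowS (X : choiceType) (t : X) i : gpow t (i + 1)%R = gpow t i * fgen t.
Proof.
have gpowN n : gpow t (Negz n) = fmk (nseq n.+1 (t, true)) by [].
have gpowP n : gpow t (Posz n) = fmk (nseq n (t, false)) by [].
case: i => [n|n].
  rewrite (_ : (Posz n + 1)%R = Posz (n + 1)); last by lia.
  by rewrite !gpowP nseqD fmk_cat.
rewrite (_ : (Negz n + 1)%R = (- Posz n)%R); last by lia.
have -> : gpow t (- Posz n)%R = fmk (nseq n (t, true)).
  by rewrite /gpow abszN; case: n => //= n; rewrite (_ : (_ < _)%R = true) //; lia.
by rewrite gpowN -addn1 nseqD fmk_cat fmk_neg mulgVK.
Qed.

(* The substitution inverse to the rewriting [rho]. *)
Definition nu (X : choiceType) (t : X) (l : X * int) : free_group X :=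
  fgen l.1 ^ (gpow t l.2)^-1.

(** For [i] = 0 and exponent sum 0 this says that [nu] undoes [rho]; the general form carries the
    running exponent. *)
Lemma nu_rho (X : choiceType) (t : X) i w :
  ev (nu t) (rho t i w) * gpow t (i + sig t w)%R = gpow t i * fmk w.
Proof.
elim: w i => [|[y e] w IH] i; first by rewrite /= mul1g GRing.addr0 mulg1.
rewrite [rho _ _ _]/= [sig _ _]/= -[_ :: w]cat1s fmk_cat mulgA GRing.addrA /xsig /=.
have [->|yt] := eqVneq y t.
  rewrite IH; congr (_ * _); case: e; last exact: gpowS.
  by rewrite fmk_neg -{2}[i](GRing.subrK 1%R) gpowS mulgK.
rewrite GRing.addr0 /= -mulgA IH mulgA; congr (_ * _).
by rewrite /evl /nu; case: e; rewrite /= ?fmk_neg -?conjVg conjgE invgK -!mulgA mulVg mulg1.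
Qed.

(** Brings a relator into the form that rewriting expects. A cyclically reduced word in [x] alone
    with exponent sum 0 is empty, which would force [z] to be trivial. *)
Lemma word_with_letter (X : choiceType) (x : X) (u z : free_group X) :
  sig x u = 0%R -> normal_closure [set u] z -> z <> 1 ->
  exists l w, [/\ l.1 != x, creduced (l :: w), sig x (l :: w) = 0%R &
    conjugate u (fmk (l :: w))].
Proof.
move=> u0 Nz z1; have ru : reduced u by case: (u).
pose c := cyc_reduce (fword u); have C : creduced c by apply: creduced_cyc_reduce.
have uc : conjugate u (fmk c) by apply: conjugate_cyc_reduce.
have c0 : sig x c = 0%R.
  have [g gE] := uc.
  by have := sigJ x u g; rewrite -gE fmk_id ?creduced_reduced // => ->.
have [l lc lx] : exists2 l, l \in c & l.1 != x.
  apply: contrapT => H; apply: z1; apply: normal_closure1.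
  have <- : fmk c = 1; last exact: conjugate_normal_closure uc Nz.
  apply: (@rho_const_nil _ x); rewrite fmk_id ?creduced_reduced //.
  case E : (rho x 0 c) => [|m v] //; exfalso; apply: H.
  have : m \in rho x 0 c by rewrite E mem_head.
  by move=> /mem_rho[mr mx]; exists (m.1.1, m.2).
exists l, (drop (index l c).+1 c ++ take (index l c) c).
rewrite -rot_index //; split=> //; first by rewrite /creduced rot_cycle.
  by rewrite /rot sig_cat GRing.addrC -sig_cat cat_take_drop.
exact: conjugate_trans uc (conjugate_rot _ _).
Qed.

(** * Rewriting over two generators *)

Section Level.
Variables (l0 : bool * bool) (w0 : seq (bool * bool)).
Hypotheses (l0x : l0.1 != true) (rC : creduced (l0 :: w0)) (rS : sig true (l0 :: w0) = 0%R).
Local Notation s := (fmk (rho true 0 (l0 :: w0))).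

Lemma letter_false : l0.1 = false. Proof. by case: l0.1 l0x. Qed.

Lemma level_freiheitssatz : freiheitssatz_at s.
Proof.
by apply: freiheitssatz; rewrite (word_step l0x rC rS); apply: rho_creduced l0x rC rS.
Qed.

Lemma level_step : exists m M : int,
    [/\ (m <= 0 <= M)%R, exists e, (false, m, e) \in fword s,
        exists e, (false, M, e) \in fword s,
        forall l, l \in fword s -> l.1.1 = false /\ (m <= l.1.2 <= M)%R
      & forall w, normal_closure [set fmk (l0 :: w0)] w ->
          (forall l, l \in rho true 0 w -> (m <= l.1.2 <= M)%R) ->
          normal_closure [set s] (fmk (rho true 0 w))].
Proof.
have [m [M []]] := rho_step l0x rC rS level_freiheitssatz.
rewrite letter_false => m0M [e1 b1] [e2 b2] H KP.
exists m, M; split=> // [| |l ls|w Nw wH]; [by exists e1 | by exists e2 | |].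
  have lf : l.1.1 = false.
    by move: ls; rewrite (word_step l0x rC rS) => /mem_rho[_]; case: l.1.1.
  by split=> //; apply: H ls lf.
by apply: KP => // l lw _; apply: wH.
Qed.
End Level.

Lemma conjugateV (G : groupType) (x y : G) : conjugate x y -> conjugate x^-1 y^-1.
Proof. by move=> [g ->]; exists g; rewrite conjVg. Qed.

(** Rewritten, [a] is a single letter of index 0, so the Freiheitssatz shrinks the window to 0. The
    relator is then a power of [a], and its exponent divides 1. *)
Lemma conjugate_normal_generator (u : F2) :
  sig true u = 0%R -> normal_closure [set u] a -> conjugate u a \/ conjugate u a^-1.
Proof.
move=> u0 Na; have a1 : a <> 1 by move/(congr1 (@fword bool)).
have [l [w [lx C S0 cu]]] := word_with_letter u0 Na a1.
have {Na} Na := conjugate_normal_closure cu Na.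
have [m [M [m0M [e1 b1] [e2 b2] H KP]]] := level_step lx C S0.
have Ns := KP _ Na; rewrite /= in Ns.
have {}Ns : normal_closure [set fmk (rho true 0 (l :: w))] (fmk [:: (false, 0%R, false)]).
  by apply: Ns => k; rewrite inE => /eqP->.
have nontriv : fmk [:: (false, 0%R : int, false)] <> 1 by move/(congr1 (@fword _)).
have M0 : M = 0%R.
  apply: contrapT => M0; apply: nontriv.
  apply: (level_freiheitssatz lx C S0) b2 Ns _ => d.
  by rewrite inE; apply/negP => /eqP[/M0].
have m0 : m = 0%R.
  apply: contrapT => m0; apply: nontriv.
  apply: (level_freiheitssatz lx C S0) b1 Ns _ => d.
  by rewrite inE; apply/negP => /eqP[/m0].
have wE := word_step lx C S0.
have no_true e : (true, e) \notin l :: w.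
  apply: (@rho_const _ true 0%R _ (creduced_reduced C) S0) => k ks.
  have := H k; rewrite wE => /(_ ks)[_].
  by rewrite m0 M0 -Order.POrderTheory.eq_le => /eqP.
have all_false k : k \in l :: w -> k.1 = false.
  by case: k => -[] d // kw; have := no_true d; rewrite kw.
move: C cu Na {Ns H KP b1 b2 wE S0 lx no_true}; case: l all_false => y e all_false.
have -> : y = false by apply: (all_false (y, e)); rewrite mem_head.
move=> /creduced_reduced rw cu Na.
have wE := reduced_nseq rw (fun k kw => all_false k (mem_behead (s := _ :: _) kw)).
have := sig_dvd_normal_closure false Na; rewrite fmk_id // wE.
rewrite -[(false, e) :: _]/(nseq (size w).+1 (false, e)) sig_nseq => dv.
have w0 : size w = 0%N.
  have : (size w).+1 %| 1.
    move: dv; rewrite dvdzE (_ : `|sig false a|%N = 1%N) // (_ : `|_|%N = (size w).+1) //.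
    by case: (e); lia.
  by rewrite dvdn1 => /eqP[].
move: cu; rewrite wE w0 /=; case: (e) => cu; [right | by left].
by rewrite /a -fmk_neg.
Qed.

Lemma sig_ev_letters (L : choiceType) (h : L -> F2) (w : seq (L * bool)) :
  (forall l, l \in w -> sig true (h l.1) = 1%R) ->
  sig true (ev h w) = (\sum_(l <- w) if l.2 then - 1 else 1)%R.
Proof.
elim: w => [|[l e] w IH] H; first by rewrite big_nil.
rewrite big_cons [ev _ _]/= sigM IH => [|k kw]; last by apply: H; rewrite inE kw orbT.
have := H (l, e) (mem_head _ _); rewrite /evl /=; case: e {H} => //= hl; last by rewrite hl.
by rewrite sigV hl.
Qed.

Lemma sum_rho i (w : seq (bool * bool)) :
  (\sum_(l <- rho true i w) (if l.2 then - 1 else 1 : int))%R = sig false w.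
Proof.
elim: w i => [|[[] e] w IH] i /=; rewrite ?big_nil //; first by rewrite IH GRing.add0r.
by rewrite big_cons IH.
Qed.

Section Magnus.
Local Notation k := (a * b * a^-1 * b^-1 : F2).

(** A conjugate of [k] rewrites to a product of two letters with consecutive indices, and the
    Freiheitssatz makes these the whole window. A change of basis of the free group on them turns
    this product into [a] and reduces the claim to [conjugate_normal_generator]. *)
Lemma relator_conjugate_commutator (r : F2) :
  sig false r = 0%R -> sig true r = 0%R -> normal_closure [set r] k ->
  conjugate r k \/ conjugate r k^-1.
Proof.
move=> ra rb Nk; have k1 : k <> 1 by move/(congr1 (@fword bool)).
have [l [w [lx C S0 cr]]] := word_with_letter rb Nk k1.
have {}Nk := conjugate_normal_closure cr Nk.
have [m [M [m0M [e1 b1] [e2 b2] H KP]]] := level_step lx C S0.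
set s := fmk (rho true 0 (l :: w)) in b1 b2 H KP.
have FR : freiheitssatz_at s := level_freiheitssatz lx C S0.
have sE : fword s = rho true 0 (l :: w) := word_step lx C S0.
have S1 : sig false (l :: w) = 0%R.
  have [g gE] := cr; have := sigJ false r g.
  by rewrite -gE fmk_id ?creduced_reduced // => ->.
(* A window of one index would make the relator a word in [a] alone with exponent sum 0, hence
   trivial. *)
have mM : m <> M.
  move=> mM; have no_true e : (true, e) \notin l :: w.
    apply: (@rho_const _ true 0%R _ (creduced_reduced C) S0) => j js.
    have := H j; rewrite sE => /(_ js)[_].
    rewrite mM -Order.POrderTheory.eq_le => /eqP <-.
    by move: m0M; rewrite mM -Order.POrderTheory.eq_le => /eqP.
  have rho0 : rho false 0 (l :: w) = [::].
    case E : (rho false 0 (l :: w)) => [|j u] //; exfalso.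
    have : j \in rho false 0 (l :: w) by rewrite E mem_head.
    by move=> /mem_rho[]; case: j.1.1 => // /(negP (no_true _)).
  have := @rho_const_nil _ false (fmk (l :: w)); rewrite fmk_id ?creduced_reduced //.
  by move=> /(_ S1 rho0) /(congr1 (@fword bool)); rewrite fmk_id ?creduced_reduced.
(* a_i a_(i+1)^-1 is conjugate to k; i is chosen so that both letters are in range. *)
pose q i : free_group (bool * int)%type := fmk [:: (false, i, false); (false, (i + 1)%R, true)].
have [i [[mi iM] Nq nuq]] : exists i, [/\ (m <= i)%R /\ (i + 1 <= M)%R,
    normal_closure [set s] (q i) & conjugate (ev (nu true) (q i)) k].
  have [M1|M0] := pselect (1 <= M)%R.
    have qE : fmk (rho true 0 k) = q 0%R by [].
    exists 0%R; split; first by lia.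
      rewrite -qE; apply: KP => // j.
      by rewrite /= !inE => /orP[] /eqP->; rewrite /= /xsig /=; lia.
    rewrite -qE ev_fmk; have := nu_rho true 0%R (fword k).
    by rewrite fmk_word mul1g mulg1 => ->; exists 1; rewrite conjg1.
  (* This conjugate of [k] rewrites with the indices -1 and 0. *)
  pose k' : F2 := b^-1 * a * b * a^-1.
  have qE : fmk (rho true 0 k') = q (-1)%R by [].
  have kk' : k' = k ^ b by rewrite /conjg /k' !mulgA mulgVK.
  exists (-1)%R; split; first by lia.
    rewrite -qE; apply: KP => [|j]; last first.
      by rewrite /= !inE => /orP[] /eqP->; rewrite /= /xsig /=; lia.
    by rewrite kk'; have [_ nJ] := normal_closure_normal [set fmk (l :: w)]; apply: nJ.
  rewrite -qE ev_fmk; have := nu_rho true 0%R (fword k').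
  rewrite fmk_word mul1g mulg1 => ->.
  by apply: conjugate_sym; exists b.
have qn1 : q i <> 1.
  move=> /(congr1 (@fword _)); rewrite fmk_id // /reduced /= andbT; apply/eqP => -[]; lia.
have mE : m = i.
  apply: contrapT => ne; apply: qn1; apply: FR b1 Nq _ => d.
  apply/negP; rewrite fmk_id; last by rewrite /reduced /= andbT; apply/eqP => -[]; lia.
  by rewrite !inE => /orP[] /eqP[]; lia.
have ME : M = (i + 1)%R.
  apply: contrapT => ne; apply: qn1; apply: FR b2 Nq _ => d.
  apply/negP; rewrite fmk_id; last by rewrite /reduced /= andbT; apply/eqP => -[]; lia.
  by rewrite !inE => /orP[] /eqP[]; lia.
have s_letter j : j \in fword s -> j.1 = (false, i) \/ j.1 = (false, (i + 1)%R).
  case: j => [[y j] e] /H /= [-> jr].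
  by have [->|ji] := eqVneq j i; [left | right; congr (_, _); lia].
(* On the two letters of the window [h] is an isomorphism onto [F2] with inverse [h']. It sends
   [q i] to [a], and both letters get [b]-exponent 1, so the [b]-exponent of the image of [s] is the
   [a]-exponent of the relator, which is 0. *)
pose h (j : bool * int) : F2 := if j == (false, i) then a * b else b.
pose h' (y : bool) : free_group (bool * int)%type := if y then fgen (false, (i + 1)%R) else q i.
have sh : sig true (ev h s) = 0%R.
  rewrite sig_ev_letters; first by rewrite sE sum_rho.
  by move=> j _; rewrite /h; case: ifP.
have hq : ev h (q i) = a.
  rewrite ev_fmk /= /evl /h /= eqxx (_ : _ == _ = false) ?mulg1 ?mulgK //.
  by apply/eqP => -[]; lia.
have Na : normal_closure [set ev h s] a.
  rewrite -hq; apply: (ev_normal_closure (normal_closure_normal _) _ Nq) => _ ->.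
  by exact (normal_closure_sub (erefl _)).
have h'hs : ev h' (ev h s) = s.
  rewrite (ev_comp _ (evM h')) (@eq_ev _ _ _ (@fgen (bool * int)%type)) ?ev_fgen ?fmk_word //.
  move=> j /s_letter jE; rewrite /= /h; case: eqP => [->|ji].
    by rewrite evM !ev_gen /h' /q -[_ :: _]cat1s fmk_cat fmk_neg mulgVK.
  by rewrite ev_gen /h'; case: jE => [/ji|->].
have nus : ev (nu true) s = fmk (l :: w).
  have := nu_rho true 0%R (l :: w).
  by rewrite ev_fmk S0 mul1g mulg1.
have conj_ev x : conjugate (ev h s) x -> conjugate r (ev (nu true) (ev h' x)).
  move=> [g ->]; rewrite evJ evJ h'hs nus; apply: conjugate_trans cr _.
  by eexists.
have h'a : ev h' a = q i by rewrite ev_gen.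
case: (conjugate_normal_generator sh Na) => /conj_ev.
  by rewrite h'a => cr1; left; apply: conjugate_trans cr1 nuq.
rewrite evV evV h'a => cr1; right; apply: conjugate_trans cr1 _.
exact: conjugateV.
Qed.

Lemma relator_of_abelian (r : F2) :
  sig false r = 0%R -> sig true r = 0%R -> normal_closure [set r] k ->
  cyclic_conjugate (cyc_reduce (fword r)) (fword (a * b * a^-1 * b^-1)) \/
  cyclic_conjugate (cyc_reduce (fword r)) (fword (b * a * b^-1 * a^-1)).
Proof.
move=> ra rb Nk; have [] := relator_conjugate_commutator ra rb Nk.
  by move=> /conjugate_cyclic; left.
move=> /conjugate_cyclic H; right.
have -> : b * a * b^-1 * a^-1 = k^-1 by rewrite !invgM !invgK !mulgA.
by [].
Qed.
End Magnus.

(** * Linear algebra over the rationals *)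

Section LinearGap.
Import GRing.Theory.
Local Open Scope ring_scope.

Definition fun_linear (E : Type) (R : Type) (L : (E -> rat) -> R -> rat) : Prop :=
  forall c f g r, L (fun e => c * f e + g e) r = c * L f r + L g r.

Lemma fun_linear_sum (E : finType) (R : Type) (L : (E -> rat) -> R -> rat) f r :
  fun_linear L -> L f r = \sum_e f e * L (fun x => (x == e)%:R) r.
Proof.
move=> lL; have L0 : L (fun=> 0) r = 0.
  have := lL (-1) (fun=> 0) (fun=> 0) r.
  have -> : (fun e : E => -1 * 0 + 0) = (fun=> 0 : rat) by apply: funext => e; rewrite mulr0 addr0.
  by move=> ->; rewrite mulN1r addNr.
have sumL s : L (fun x => \sum_(e <- s) f e * (x == e)%:R) r =
    \sum_(e <- s) f e * L (fun x => (x == e)%:R) r.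
  elim: s => [|e s IH].
    by rewrite big_nil; apply: etrans L0; congr (L _ r); apply: funext => x; rewrite big_nil.
  rewrite big_cons -IH -lL; congr (L _ r).
  by apply: funext => x; rewrite big_cons.
rewrite -sumL; congr (L _ r); apply: funext => x.
rewrite (bigD1 x) //= eqxx mulr1 big1 ?addr0 // => e ex.
by rewrite eq_sym (negbTE ex) mulr0.
Qed.

(** The kernel of [L] has dimension at least |E| - |R|, more than |D|, which bounds the rank of
    [de]; so the image cannot contain the kernel. *)
Lemma linear_gap (E R D : finType) (L : (E -> rat) -> R -> rat) (de : (D -> rat) -> E -> rat) :
  fun_linear L -> fun_linear de -> (#|R| + #|D| < #|E|)%N ->
  exists f, (forall r, L f r = 0) /\ forall d, f <> de d.
Proof.
move=> lL lde lt.
pose vecf (T : finType) (v : 'rV[rat]_#|T|) (e : T) := v 0 (enum_rank e).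
pose mxf (T U : finType) (M : (T -> rat) -> U -> rat) : 'M[rat]_(#|T|, #|U|) :=
  \matrix_(i, j) M (fun x => (x == enum_val i)%:R) (enum_val j).
have mxfE (T U : finType) (M : (T -> rat) -> U -> rat) v :
    fun_linear M -> M (vecf _ v) = vecf _ (v *m mxf _ _ M).
  move=> lM; apply: funext => u; rewrite fun_linear_sum // /vecf mxE.
  rewrite (reindex_onto enum_val enum_rank) /=; last by move=> e _; rewrite enum_rankK.
  apply: eq_big => [i|i _]; first by rewrite enum_valK eqxx.
  by rewrite mxE enum_valK enum_rankK.
have nsub : ~~ (kermx (mxf _ _ L) <= mxf _ _ de)%MS.
  apply/negP => /mxrankS; rewrite mxrank_ker.
  have := rank_leq_col (mxf _ _ L); have := rank_leq_row (mxf _ _ de); lia.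
have /row_subPn[i ni] := nsub.
exists (vecf _ (row i (kermx (mxf _ _ L)))); split=> [r|d dE].
  by rewrite mxfE // -row_mul mulmx_ker row0 /vecf mxE.
move/negP: ni; apply.
pose w : 'rV[rat]_#|D| := \row_j d (enum_val j).
have wd : vecf _ w = d by apply: funext => e; rewrite /vecf mxE enum_rankK.
apply/submxP; exists w; apply/rowP => j.
move: dE; rewrite -wd mxfE // => /(congr1 (fun g => g (enum_val j))).
by rewrite /vecf enum_valK.
Qed.
End LinearGap.

(** * Additive cocycles *)

Section AdditiveCocycle.
Import GRing.Theory.
Variables (X T : choiceType) (A : faction X T) (V : zmodType) (f : X -> T -> V).

Definition zcol (l : X * bool) (t : T) : V :=
  (if l.2 then - f l.1 (fstep A l t) else f l.1 t)%R.

Fixpoint zco (w : seq (X * bool)) (t : T) : V :=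
  if w is l :: w' then (zcol l t + zco w' (fstep A l t))%R else 0%R.

Lemma zcolV l t : zcol (invl l) (fstep A l t) = (- zcol l t)%R.
Proof.
case: l => x []; rewrite /zcol /= ?opprK //.
by rewrite (fstepK A (x, false)).
Qed.

Lemma zco_cat w w' t : zco (w ++ w') t = (zco w t + zco w' (act A w t))%R.
Proof. by elim: w t => [|l w IH] t /=; rewrite ?add0r // IH addrA. Qed.

Lemma zco_reduce w t : zco (reduce w) t = zco w t.
Proof.
elim: w t => [|l w IH] t //=; rewrite -IH /cons_red.
case: (reduce w) => [|m w'] //; case: eqP => [->|] //=.
by rewrite zcolV fstepK addrA addrN add0r.
Qed.

Lemma zcoM (x y : free_group X) t : zco (x * y) t = (zco x t + zco y (act A x t))%R.
Proof. by rewrite zco_reduce zco_cat. Qed.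

Lemma zcoV (x : free_group X) t : zco x^-1 t = (- zco x (act A x^-1%g t))%R.
Proof.
have : zco (x^-1 * x) t = 0%R by rewrite mulVg.
by rewrite zcoM => /eqP; rewrite addr_eq0 => /eqP.
Qed.

(** The 2-cell at [t] is a square whose opposite sides enter with opposite signs; this makes sums
    over a torus telescope. *)
Lemma zco_commutator (u v : free_group X) t :
  act A (u * v) t = act A (v * u) t ->
  zco (u * v * u^-1 * v^-1) t =
    (zco u t + zco v (act A u t) - zco u (act A v t) - zco v t)%R.
Proof.
move=> uv; rewrite 3!zcoM !(zcoV, actM) in uv *.
by rewrite uv !actK.
Qed.

(** The potential integrates along a path from a base point chosen in each orbit; vanishing on loops
    makes the path immaterial. *)
Lemma zco_coboundary : (forall w t, act A w t = t -> zco w t = 0%R) ->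
  exists d : T -> V, forall w t, zco w t = (d (act A w t) - d t)%R.
Proof.
move=> loop0; pose orb t : set T := [set t' | exists w : free_group X, act A w t' = t].
have orb_self t : orb t t by exists 1.
pose base t : T := xget t (orb t).
have base_in t : orb t (base t) by apply: (@xgetPex _ t (orb t)); exists t.
have orb_act (w : free_group X) t : orb (act A w t) = orb t.
  apply/seteqP; split=> t' [w' e].
    by exists (w' * w^-1); rewrite actM e actK.
  by exists (w' * w); rewrite actM e.
have base_act (w : free_group X) t : base (act A w t) = base t.
  by rewrite /base orb_act /xget; case: pselect => // -[]; exists t; apply/asboolP.
have [path pathP] : exists path : T -> free_group X, forall t, act A (path t) (base t) = t.
  have /choice[p pP] : forall t, exists w : free_group X, act A w (base t) = t by exact: base_in.
  by exists p.
exists (fun t => zco (path t) (base t)) => w t.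
have := loop0 (path t * fmk w * (path (act A w t))^-1) (base t).
have aw : act A (fmk w) t = act A w t by apply: act_reduce.
rewrite !actM pathP aw.
have pE : act A (path (act A w t))^-1 (act A w t) = base t.
  by rewrite -{2}[act A w t]pathP actK -aw base_act.
move=> /(_ pE); rewrite !zcoM !actM pathP zcoV aw pE zco_reduce.
by rewrite -aw base_act aw => /subr0_eq <-; rewrite addrC addKr.
Qed.
End AdditiveCocycle.

Section CocycleMorphism.
Import GRing.Theory.
Variables (X T : choiceType) (A : faction X T).

Lemma zco_additive (V W : zmodType) (f : X -> T -> V) (phi : V -> W) w t :
  {morph phi : x y / (x + y)%R} ->
  zco A (fun x t => phi (f x t)) w t = phi (zco A f w t).
Proof.
move=> phiD; have phi0 : phi 0%R = 0%R by apply: (addrI (phi 0%R)); rewrite -phiD !addr0.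
have phiN x : phi (- x)%R = (- phi x)%R.
  by apply: (addrI (phi x)); rewrite -phiD !subrr.
elim: w t => [|l w IH] t //=.
by rewrite IH phiD /zcol; case: l.2; rewrite ?phiN.
Qed.

Lemma zco_linear (c : rat) (f g : X -> T -> rat) w t :
  zco A (fun x t => c * f x t + g x t)%R w t = (c * zco A f w t + zco A g w t)%R.
Proof.
elim: w t => [|l w IH] t /=; first by rewrite mulr0 addr0.
by rewrite IH /zcol; case: l.2; ring.
Qed.

Variable c : X -> T -> int.
(** The infinite cyclic cover determined by [c], with the level as second coordinate. *)
Definition zstep (l : X * bool) (p : T * int) : T * int :=
  (fstep A l p.1, p.2 + zcol A c l p.1)%R.
Lemma zstepK l : cancel (zstep l) (zstep (invl l)).
Proof. by case=> t m; rewrite /zstep /= fstepK zcolV addrK. Qed.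
Definition zext := FAction zstepK.

Lemma act_zext w t (m : int) : act zext w (t, m) = (act A w t, m + zco A c w t)%R.
Proof.
elim: w t m => [|l w IH] t m /=; first by rewrite addr0.
by rewrite -/(act zext w _) IH addrA.
Qed.

Lemma zco_shift (V : zmodType) (f g : X -> T * int -> V) (i : int) w t (m : int) :
  (forall x t m, f x (t, m + i)%R = g x (t, m)) ->
  zco zext f w (t, m + i)%R = zco zext g w (t, m).
Proof.
move=> fg; elim: w t m => [|l w IH] t m //=.
rewrite /zstep /= addrAC IH; congr (_ + _)%R; rewrite /zcol /= /zstep /=.
by rewrite addrAC !fg.
Qed.

Variable C : nat.
Hypothesis cC : forall x t, (`|c x t| <= C)%N.

Lemma zcol_bound l t : (`|zcol A c l t| <= C)%N.
Proof. by case: l => x [] /=; rewrite ?abszN cC. Qed.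

(** Each letter changes the level by at most [C], so a word sees only labels on levels within
    [C * size w] of its start. *)
Lemma zco_local (V : zmodType) (f : X -> T * int -> V) w t (m : int) :
  (forall x t' (m' : int), (`|(m' - m)%R| <= C * size w)%N -> f x (t', m') = 0%R) ->
  zco zext f w (t, m) = 0%R.
Proof.
elim: w t m => [|l w IH] t m //= H; rewrite IH => [|x t' m' /= m'm]; last first.
  by apply: H; move: m'm; have := zcol_bound l t; rewrite /= mulnS; lia.
rewrite addr0 /zcol /= /zstep /=; have := zcol_bound l t; rewrite mulnS in H.
by case: l.2 => lb; rewrite H ?oppr0 //; lia.
Qed.

Variable K : groupType.

Lemma coc_local (mu : X -> T * int -> K) (f : X -> T * int -> int) (phi : int -> K) w t (m : int) :
  (forall i j, phi (i + j)%R = phi i * phi j) ->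
  (forall x t' (m' : int), (`|(m' - m)%R| <= C * size w)%N -> mu x (t', m') = phi (f x (t', m'))) ->
  coc zext mu w (t, m) = phi (zco zext f w (t, m)).
Proof.
move=> phiD; have phi0 : phi 0%R = 1.
  by apply: (mulgI (phi 0%R)); rewrite -phiD addr0 mulg1.
have phiN i : phi (- i)%R = (phi i)^-1.
  by apply/esym/mulg1_eq; rewrite -phiD subrr.
elim: w t m => [|l w IH] t m //= H; rewrite IH => [|x t' m' /= m'm]; last first.
  by apply: H; move: m'm; have := zcol_bound l t; rewrite /= mulnS; lia.
rewrite phiD; congr (_ * _); rewrite /zcol /cocl /= /zstep /=.
have := zcol_bound l t; rewrite mulnS in H.
by case: l.2 => lb; rewrite H ?phiN //; lia.
Qed.

Lemma coc_shift (mu : X -> T * int -> K) (y : K) (i : int) w t (m : int) :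
  (forall x t m, mu x (t, m + i)%R = mu x (t, m) ^ y) ->
  coc zext mu w (t, m + i)%R = coc zext mu w (t, m) ^ y.
Proof.
move=> muy; elim: w t m => [|l w IH] t m /=; first by rewrite conj1g.
rewrite conjMg /zstep /= addrAC IH; congr (_ * _); rewrite /cocl /= /zstep /=.
by rewrite addrAC !muy; case: l.2; rewrite ?conjVg.
Qed.

End CocycleMorphism.

(** * Two covers *)

Lemma clear_denominators (E : finType) (f : E -> rat) :
  exists (N : int) (g : E -> int), N != 0%R /\ forall e, ((g e)%:~R = N%:~R * f e)%R.
Proof.
pose N : int := (\prod_e denq (f e))%R.
exists N, (fun e => numq (f e) * \prod_(e' | e' != e) denq (f e'))%R; split.
  by rewrite /N; apply/GRing.prodf_neq0 => e _; apply: denq_neq0.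
move=> e; have -> : N = (denq (f e) * \prod_(e' | e' != e) denq (f e'))%R.
  by rewrite /N (bigD1 e).
rewrite !intrM GRing.mulrAC; congr (_ * _)%R.
by rewrite numqE GRing.mulrC.
Qed.

Lemma act_commutator (X : choiceType) (T : Type) (A : faction X T) (u v : free_group X) t :
  act A (u * v * u^-1 * v^-1) t = t -> act A (u * v) t = act A (v * u) t.
Proof.
rewrite !actM => e; rewrite -{1}(actVK A u (act A v _)).
by rewrite -{1}(actVK A v (act A u^-1 _)) e.
Qed.

(** An injective self-map of a finite set permutes it, so the shifted sums equal the unshifted ones:
    the boundaries of the cells of a closed torus add up to zero. *)
Lemma sum_commutator (V : zmodType) (T : finType) (S : {set T}) (fu fv : T -> T) (g h : T -> V) :
  injective fu -> injective fv ->
  (forall q, q \in S -> fu q \in S) -> (forall q, q \in S -> fv q \in S) ->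
  (\sum_(q in S) (g q + h (fu q) - g (fv q) - h q) = 0)%R.
Proof.
move=> iu iv Su Sv.
have sumE (F : T -> V) (p : T -> T) : injective p -> (forall q, q \in S -> p q \in S) ->
    (\sum_(q in S) F (p q) = \sum_(q in S) F q)%R.
  move=> ip Sp; rewrite -(big_imset F) /=; last by move=> x y _ _; apply: ip.
  suff -> : p @: S = S by [].
  apply/eqP; rewrite eqEcard card_imset // leqnn andbT.
  by apply/fintype.subsetP => _ /imsetP[q qS ->]; apply: Sp.
rewrite !big_split /= !GRing.sumrN (sumE h) // (sumE g) // GRing.addrAC GRing.addrK GRing.subrr //.
Qed.

Section TwoCovers.
Variables (Om : finType) (A : faction bool Om) (u v : F2) (O : {set Om}) (o q1 : Om).
Local Notation r := (u * v * u^-1 * v^-1 : F2).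
Hypotheses (oO : o \in O) (q1O : q1 \notin O).
Hypotheses (Ou : forall q, q \in O -> act A u q \in O)
  (Ov : forall q, q \in O -> act A v q \in O).
Hypothesis Oind : forall P : Om -> Prop, P o ->
  (forall q, q \in O -> P q -> P (act A u q) /\ P (act A v q)) -> forall q, q \in O -> P q.
Hypothesis rA : forall q, act A r q = q.

Let uv q : act A (u * v) q = act A (v * u) q.
Proof. exact: act_commutator. Qed.

Lemma act_injective (w : F2) : injective (act A w).
Proof. exact: can_inj (actK A w). Qed.

Lemma complement_closed (w : F2) : (forall q, q \in O -> act A w q \in O) ->
  forall q, q \in ~: O -> act A w q \in ~: O.
Proof.
move=> Ow q; rewrite !inE; apply: contra => wO.
have wE : act A w @: O = O.
  apply/eqP; rewrite eqEcard card_imset ?leqnn ?andbT; last exact: act_injective.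
  by apply/fintype.subsetP => _ /imsetP[p pO ->]; apply: Ow.
by move: wO; rewrite -{1}wE => /imsetP[p pO /act_injective ->].
Qed.

(* Imposing c_u = c_v = 0 on O and c_r = 0 off O: the equation at q1 may be dropped, since the
   values c_r sum to zero over the complement of O. This leaves 2|O| + (|Om| - |O| - 1) equations in
   2|Om| unknowns, against |Om| - |O| dimensions of coboundaries. *)
Lemma cocycle_on_finite_cover : exists c : bool -> Om -> int,
  [/\ forall q, q \in O -> zco A c u q = 0%R /\ zco A c v q = 0%R,
      forall q, zco A c r q = 0%R
    & exists q (w : F2), act A w q = q /\ zco A c w q != 0%R].
Proof.
pose D := {q : Om | q \notin O}.
pose R := (bool * {q : Om | q \in O} + {q : Om | (q \notin O) && (q != q1)})%type.
pose cf (f : bool * Om -> rat) x q := f (x, q).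
pose L (f : bool * Om -> rat) (i : R) : rat :=
  match i with
  | inl (b, q) => zco A (cf f) (fword (if b then v else u)) (val q)
  | inr q => zco A (cf f) r (val q)
  end.
pose ext (d : D -> rat) (q : Om) : rat := if insub q is Some s then d s else 0%R.
pose de (d : D -> rat) (e : bool * Om) : rat :=
  (ext d (fstep A (e.1, false) e.2) - ext d e.2)%R.
have lL : fun_linear L by move=> c f g [[b q]|q]; apply: zco_linear.
have lde : fun_linear de.
  move=> c f g [x q]; rewrite /de /ext /=.
  by case: insub => [?|]; case: insub => [?|]; ring.
have cardlt : (#|{: R}| + #|{: D}| < #|{: bool * Om}|)%N.
  rewrite card_sum !card_prod card_bool !card_sig.
  have e1 : (#|[pred q | q \in O]| + #|[pred q | q \notin O]| = #|Om|)%N.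
    by rewrite -(cardC (mem O)); congr addn; apply: eq_card => q; rewrite !inE.
  have e2 : (#|[pred q | (q \notin O) && (q != q1)]| < #|[pred q | q \notin O]|)%N.
    apply: proper_card; apply/properP; split.
      by apply/fintype.subsetP => q; rewrite !inE => /andP[].
    by exists q1; rewrite !inE ?q1O // eqxx andbF.
  by rewrite -e1; lia.
have [f [Lf0 fd]] := linear_gap lL lde cardlt.
have fO q : q \in O -> zco A (cf f) u q = 0%R /\ zco A (cf f) v q = 0%R.
  move=> qO; split; first exact: (Lf0 (inl (false, exist _ q qO))).
  exact: (Lf0 (inl (true, exist _ q qO))).
have zr q := zco_commutator (cf f) (uv q).
have frO q : q \in O -> zco A (cf f) r q = 0%R.
  move=> qO; rewrite zr; have [-> ->] := fO q qO.
  have [_ ->] := fO _ (Ou qO); have [-> _] := fO _ (Ov qO).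
  ring.
have fr q : q != q1 -> zco A (cf f) r q = 0%R.
  move=> qq1; have [/frO //|qO] := boolP (q \in O).
  have H : (q \notin O) && (q != q1) by rewrite qO.
  exact: (Lf0 (inr (exist _ q H))).
have frq1 : zco A (cf f) r q1 = 0%R.
  have : (\sum_(q in ~: O) zco A (cf f) r q = 0)%R.
    under eq_bigr => q _ do rewrite zr.
    by apply: sum_commutator; [apply: act_injective | apply: act_injective
      | apply: complement_closed | apply: complement_closed].
  rewrite (bigD1 q1) /=; last by rewrite inE.
  by rewrite big1 ?GRing.addr0 // => q /andP[_ /fr].
have {frO fr frq1} fr q : zco A (cf f) r q = 0%R by have [->|/fr] := eqVneq q q1.
have [[q [w [wq nz]]]|H] :=
  pselect (exists q (w : F2), act A w q = q /\ zco A (cf f) w q != 0%R); last first.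
  (* Otherwise [f] has a potential [d], which is constant on [O] because [f] vanishes along [u] and
     [v] there. Subtracting that constant puts [f] in the image of [de]. *)
  exfalso; have [|d dE] := @zco_coboundary _ _ A _ (cf f).
    by move=> w q wq; apply: contrapT => /eqP nz; apply: H; exists q, (fmk w);
      rewrite /= zco_reduce; split=> //; rewrite act_reduce.
  apply: (fd (fun s => d (val s) - d o)%R); apply: funext => -[x q].
  have d0 q' : q' \in O -> d q' = d o.
    apply: (Oind (P := fun q' => d q' = d o)) => // p pO <-; have [e1 e2] := fO p pO.
    by move: e1 e2; rewrite !dE => /GRing.subr0_eq -> /GRing.subr0_eq ->.
  have extE p : ext (fun s => d (val s) - d o)%R p = (d p - d o)%R.
    rewrite /ext; case: insubP => [s _ <- //|]; rewrite negbK => /d0 ->.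
    by rewrite GRing.subrr.
  rewrite /de !extE /=; have := dE [:: (x, false)] q; rewrite /= GRing.addr0 /zcol /cf /= => ->.
  by ring.
have [N [g [N0 gE]]] := clear_denominators f.
have cE w' q' : ((zco A (fun x q => g (x, q)) w' q')%:~R = N%:~R * zco A (cf f) w' q' :> rat)%R.
  rewrite -(zco_additive A (fun x q => g (x, q)) (phi := fun i : int => i%:~R%R)); last first.
    by move=> i j; rewrite intrD.
  rewrite -(zco_additive A (cf f) (phi := fun i : rat => (N%:~R * i)%R)); last first.
    by move=> i j; rewrite GRing.mulrDr.
  by congr (zco A _ w' q'); apply: funext => x; apply: funext => p; rewrite gE.
have c0 w' q' : zco A (cf f) w' q' = 0%R -> zco A (fun x q => g (x, q)) w' q' = 0%R.
  move=> z0; apply/eqP; rewrite -(intr_eq0 rat) cE z0 GRing.mulr0 //.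
exists (fun x q => g (x, q)); split=> [q' q'O|q'|].
- by have [e1 e2] := fO q' q'O; split; apply: c0.
- exact: c0.
exists q, w; split=> //.
by rewrite -(intr_eq0 rat) cE GRing.mulf_neq0 // intr_eq0.
Qed.

(* Here the equation at (o, m) may be dropped for each level m, since O lifts to that level. For
   cocycles supported in M levels this leaves (|Om| - 1)(M + 2 be) equations in 2|Om|M unknowns,
   against |Om|(M + 2 be) dimensions of coboundaries; M = 4|Om|be + 1 is large enough. *)
Lemma cocycle_on_infinite_cover (c : bool -> Om -> int) :
  (forall q, q \in O -> zco A c u q = 0%R /\ zco A c v q = 0%R) ->
  (forall q, zco A c r q = 0%R) ->
  exists (f : bool -> Om * int -> int) (M : nat),
  [/\ forall x q m, f x (q, m) <> 0%R -> (0 <= m < M%:Z)%R,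
      forall p, zco (zext A c) f r p = 0%R
    & exists p (w : F2), act (zext A c) w p = p /\ zco (zext A c) f w p != 0%R].
Proof.
clear q1O Oind; move=> cO cr; pose B := zext A c.
have [C cC] : exists C : nat, forall x q, (`|c x q| <= C)%N.
  exists (\max_(e : bool * Om) `|c e.1 e.2|%N) => x q.
  exact: (leq_bigmax (x, q)).
have BE w q m : act B w (q, m) = (act A w q, m + zco A c w q)%R by apply: act_zext.
have rB p : act B r p = p by case: p => q m; rewrite BE rA cr GRing.addr0.
(* [be] bounds the reach of the relator and of a single edge: beyond this margin the relator
   equations hold automatically, and edges from the support end within it. *)
pose be := (C * size (fword r) + C)%N; pose n := #|Om|; pose M := (4 * n * be + 1)%N.
pose D := (Om * 'I_(M + 2 * be))%type; pose R := ({q : Om | q != o} * 'I_(M + 2 * be))%type.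
pose E := (bool * Om * 'I_M)%type.
(* Extension by zero from the levels 0 to [K] - 1 to all levels. *)
have wfP (V : zmodType) (K : nat) : exists wf : ('I_K -> V) -> int -> V,
    (forall g (i : 'I_K), wf g (Posz i) = g i) /\
    (forall g m, ~ (0 <= m < K%:Z)%R -> wf g m = 0%R).
  exists (fun g m => if m is Posz k then if insub k is Some i then g i else 0%R else 0%R).
  split=> [g i|g [k|k] //]; first by rewrite valK.
  by case: insubP => // i _ <- []; have := ltn_ord i; lia.
have inP K m : (0 <= m < K%:Z)%R -> exists i : 'I_K, m = Posz i.
  case: m => // k kK; have kK' : (k < K)%N by lia.
  by exists (Ordinal kK').
have [wf [wfE wf0]] := wfP rat M; have [we [weE we0]] := wfP rat (M + 2 * be)%N.
have wf_lin k g h m : (wf (fun i => k * g i + h i) m = k * wf g m + wf h m)%R.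
  have [/inP[i ->]|out] := pselect (0 <= m < M%:Z)%R; first by rewrite !wfE.
  by rewrite !wf0 // GRing.mulr0 GRing.addr0.
have we_lin k g h m : (we (fun i => k * g i + h i) m = k * we g m + we h m)%R.
  have [/inP[i ->]|out] := pselect (0 <= m < (M + 2 * be)%:Z)%R; first by rewrite !weE.
  by rewrite !we0 // GRing.mulr0 GRing.addr0.
pose cf (f : E -> rat) x (p : Om * int) := wf (fun i => f (x, p.1, i)) p.2.
pose L (f : E -> rat) (i : R) : rat := zco B (cf f) r (val i.1, Posz i.2 - Posz be)%R.
pose ext (d : D -> rat) (p : Om * int) : rat := we (fun j => d (p.1, j)) (p.2 + Posz be)%R.
pose de (d : D -> rat) (e : E) : rat :=
  (ext d (fstep B (e.1.1, false) (e.1.2, Posz e.2)) - ext d (e.1.2, Posz e.2))%R.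
have cf_lin k f g : cf (fun e => k * f e + g e)%R = fun x p => (k * cf f x p + cf g x p)%R.
  by apply: funext => x; apply: funext => p; rewrite /cf wf_lin.
have lL : fun_linear L by move=> k f g [q i]; rewrite /L cf_lin zco_linear.
have lde : fun_linear de by move=> k f g [[x q] i]; rewrite /de /ext !we_lin; ring.
have count_lt (e j : nat) : (0 < j)%N ->
    (j.-1 * (4 * j * e + 1 + 2 * e) + j * (4 * j * e + 1 + 2 * e) < 2 * j * (4 * j * e + 1))%N.
  by case: j => [|j] // _; rewrite /=; nia.
have cardlt : (#|{: R}| + #|{: D}| < #|{: E}|)%N.
  rewrite !card_prod card_bool !card_sig !card_ord cardC1.
  have n0 : (0 < n)%N by apply/card_gt0P; exists o.
  exact: count_lt.
have [f [Lf0 fd]] := linear_gap lL lde cardlt.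
have out q m : ~ (- Posz be <= m < M%:Z + Posz be)%R -> zco B (cf f) r (q, m) = 0%R.
  move=> nm; refine (@zco_local _ _ A c C cC _ (cf f) r q m _) => x q' m' le.
  rewrite /cf /=; apply: wf0.
  by move: le nm; rewrite /be; lia.
have fr q m : q != o -> zco B (cf f) r (q, m) = 0%R.
  move=> qo; have [inm|/out-> //] := pselect (- Posz be <= m < M%:Z + Posz be)%R.
  have [|i mi] := inP (M + 2 * be)%N (m + Posz be)%R; first by lia.
  have := Lf0 (exist _ q qo, i); rewrite /L /= -mi.
  by rewrite GRing.addrK.
have uvB p : act B (u * v) p = act B (v * u) p by apply: act_commutator.
have frO m : zco B (cf f) r (o, m) = 0%R.
  have : (\sum_(q in O) zco B (cf f) r (q, m) = 0)%R.
    have uO q : q \in O -> act B u (q, m) = (act A u q, m).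
      by move=> /cO[e _]; rewrite BE e GRing.addr0.
    have vO q : q \in O -> act B v (q, m) = (act A v q, m).
      by move=> /cO[_ e]; rewrite BE e GRing.addr0.
    under eq_bigr => q qO do rewrite (zco_commutator (cf f) (uvB _)) uO // vO //.
    by apply: (sum_commutator (fun q => zco B (cf f) u (q, m)) (fun q => zco B (cf f) v (q, m)));
      try exact: act_injective.
  rewrite (bigD1 o) //= big1 ?GRing.addr0 // => q /andP[_ qo].
  exact: fr.
have {fr frO} fr p : zco B (cf f) r p = 0%R.
  by case: p => q m; have [->|/fr] := eqVneq q o.
have [[p [w [wp nz]]]|H] :=
  pselect (exists p (w : F2), act B w p = p /\ zco B (cf f) w p != 0%R); last first.
  exfalso; have [|d dE] := @zco_coboundary _ _ B _ (cf f).
    by move=> w p wp; apply: contrapT => /eqP nz; apply: H; exists p, (fmk w);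
      rewrite /= zco_reduce; split=> //; rewrite act_reduce.
  apply: (fd (fun s => d (s.1, Posz s.2 - Posz be)%R)); apply: funext => -[[x q] i].
  have extE q' m : (- Posz be <= m < M%:Z + Posz be)%R ->
      ext (fun s => d (s.1, Posz s.2 - Posz be)%R) (q', m) = d (q', m).
    move=> mr; rewrite /ext /=; have [|j mj] := inP (M + 2 * be)%N (m + Posz be)%R; first by lia.
    by rewrite mj weE /= -mj GRing.addrK.
  have iM := ltn_ord i; have cx := cC x q.
  rewrite /de /= /zstep /= !extE; first last.
  - by rewrite /zcol /= /be; lia.
  - by lia.
  have := dE [:: (x, false)] (q, Posz i).
  by rewrite /= /zstep /= GRing.addr0 /zcol /cf /= wfE => ->.
have [N [g [N0 gE]]] := clear_denominators f.
have [wi [wiE wi0]] := wfP int M.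
pose cg x (p : Om * int) : int := wi (fun i => g (x, p.1, i)) p.2.
have cE w' p' : ((zco B cg w' p')%:~R = N%:~R * zco B (cf f) w' p' :> rat)%R.
  rewrite -(zco_additive B cg (phi := fun i : int => i%:~R%R)); last first.
    by move=> i j; rewrite intrD.
  rewrite -(zco_additive B (cf f) (phi := fun i : rat => (N%:~R * i)%R)); last first.
    by move=> i j; rewrite GRing.mulrDr.
  congr (zco B _ w' p'); apply: funext => x; apply: funext => -[q m].
  rewrite /cg /cf /=; have [/inP[i ->]|outm] := pselect (0 <= m < M%:Z)%R.
    by rewrite wiE wfE gE.
  by rewrite wi0 // wf0 // GRing.mulr0.
exists cg, M; split=> [x q m|p'|].
- by move=> nz0; apply: contrapT => outm; apply: nz0; rewrite /cg wi0.
- by apply/eqP; rewrite -(intr_eq0 rat) cE fr GRing.mulr0.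
exists p, w; split=> //.
by rewrite -(intr_eq0 rat) cE GRing.mulf_neq0 // intr_eq0.
Qed.
End TwoCovers.

(** * Largeness *)

Lemma gpow0 (X : choiceType) (t : X) : gpow t 0%R = 1.
Proof. by []. Qed.

Lemma gpowD (X : choiceType) (t : X) (i j : int) : gpow t (i + j)%R = gpow t i * gpow t j.
Proof.
have gpowP n : gpow t (i + Posz n)%R = gpow t i * gpow t (Posz n).
  elim: n => [|n IH]; first by rewrite GRing.addr0 gpow0 mulg1.
  rewrite (_ : (i + Posz n.+1)%R = (i + Posz n + 1)%R); last by lia.
  rewrite (_ : Posz n.+1 = (Posz n + 1)%R); last by lia.
  by rewrite !gpowS IH mulgA.
case: j => [n|n]; first exact: gpowP.
elim: n => [|n IH].
  apply: (mulIg (fgen t)); rewrite -gpowS -mulgA -gpowS.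
  rewrite (_ : (i + Negz 0 + 1)%R = i); last by lia.
  by rewrite (_ : (Negz 0 + 1)%R = 0%R) ?gpow0 ?mulg1.
apply: (mulIg (fgen t)); rewrite -gpowS -mulgA -gpowS.
rewrite (_ : (i + Negz n.+1 + 1)%R = (i + Negz n)%R); last by lia.
by rewrite (_ : (Negz n.+1 + 1)%R = Negz n) //; lia.
Qed.

Lemma gpowN (X : choiceType) (t : X) (i : int) : gpow t (- i)%R = (gpow t i)^-1.
Proof. by apply/esym/mulg1_eq; rewrite -gpowD GRing.subrr. Qed.

(* Compare the third coordinates of x y and y x in the integer Heisenberg group. *)
Lemma commute_exponents (x y : F2) :
  x * y = y * x -> (sig false x * sig true y = sig false y * sig true x)%R.
Proof.
pose sh (x : bool) (i : int) : int := (if x then i else i + 1)%R.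
pose sh' (x : bool) (i : int) : int := (if x then i else i - 1)%R.
have shK x' : cancel (sh x') (sh' x') by case: x' => i; rewrite /sh /sh' ?GRing.addrK.
have sh'K x' : cancel (sh' x') (sh x') by case: x' => i; rewrite /sh /sh' ?GRing.subrK.
pose A := bij_action shK sh'K.
pose f (x : bool) (i : int) : int := (if x then i else 0)%R.
have actE w i : act A w i = (i + sig false w)%R.
  elim: w i => [|[[] []] w IH] i;
    by rewrite [act _ _ _]/= -?/(act A w _) ?IH /= ?/bij_step /xsig /=; lia.
have fE w i : zco A f w i = (zco A f w 0 + i * sig true w)%R.
  elim: w i => [|[x' e] w IH] i; first by rewrite /=; lia.
  rewrite /= IH [in RHS]IH /zcol /bij_step /xsig /f /sh /sh' /=.
  by case: x'; case: e => /=; ring.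
move=> /(congr1 (fun w : F2 => zco A f w 0%R)); rewrite !zcoM !actE.
rewrite (fE y (0 + _)%R) (fE x (0 + _)%R) !GRing.add0r.
by rewrite GRing.addrCA => /GRing.addrI /GRing.addrI.
Qed.

Lemma finite_range_key (G : Type) (T : finType) (U : Type) (F : G -> U) (key : G -> T) :
  (forall g g', key g = key g' -> F g = F g') -> finite_set (range F).
Proof.
move=> H; have [[g0 _]|nG] := pselect (exists g0 : G, True); last first.
  rewrite (_ : range F = set0) //; apply/seteqP; split=> // x [g _ _].
  by case: nG; exists g.
have [sec secP] : exists sec : T -> G, forall g, key (sec (key g)) = key g.
  have /choice[sec secP] : forall t : T, exists g, (exists g', key g' = t) -> key g = t.
    move=> t; have [[g gt]|n] := pselect (exists g, key g = t); first by exists g.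
    by exists g0 => /n.
  by exists sec => g; apply: secP; exists g.
apply: (@sub_finite_set _ _ ((F \o sec) @` setT)).
  by move=> _ [g _ <-]; exists (key g) => //=; apply: H.
exact/finite_image/finite_finset.
Qed.

Lemma presented_finitely_generated (R : set F2) : finitely_generated (presented_group R).
Proof.
exists [set \pi_(presented_group R) a; \pi_(presented_group R) b].
  exact: finite_set2.
apply/seteqP; split=> // g _; elim/quotW: g => w H [[H1 HM HV] HS].
rewrite -[w]fmk_word; elim: (fword w) => [|l u IH]; first exact: H1.
rewrite -cat1s fmk_cat pres_pi_morph; apply: HM => //.
have Hg x : H (\pi_(presented_group R) (fgen x)).
  by apply: HS; case: x; [right | left].
by case: l => x []; rewrite ?fmk_neg ?pres_pi_inv; [apply/HV/Hg | apply: Hg].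
Qed.

Lemma divz_modz_small (k j i : int) : (0 <= i < k)%R ->
  ((j * k + i) %/ k)%Z = j /\ ((j * k + i) %% k)%Z = i.
Proof.
move=> ik; have k0 : k != 0%R by apply/eqP; lia.
by rewrite divzMDl // modzMDl divz_small ?modz_small ?GRing.addr0 //; lia.
Qed.

Section Large.
Variables (Om : finType) (A : faction bool Om) (u v : F2) (O : {set Om}) (o q1 : Om).
Local Notation r := (u * v * u^-1 * v^-1 : F2).
Local Notation G := (presented_group [set r]).
Hypotheses (oO : o \in O) (q1O : q1 \notin O).
Hypotheses (Ou : forall q, q \in O -> act A u q \in O)
  (Ov : forall q, q \in O -> act A v q \in O).
Hypothesis Oind : forall P : Om -> Prop, P o ->
  (forall q, q \in O -> P q -> P (act A u q) /\ P (act A v q)) -> forall q, q \in O -> P q.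
Hypothesis rA : forall q, act A r q = q.
Hypothesis transA : forall q q', exists w : F2, act A w q = q'.

(** With [s] and [z] for the generators [false] and [true], [th] maps [H] to [F2]. Its image
    contains a nontrivial power of [z] and an element of nonzero [s]-exponent; these do not commute,
    so [subgroup_onto_F2] applies to the image. *)
Lemma large_of_intransitive : large G.
Proof.
split; first exact: presented_finitely_generated.
have [c [cO cr [q2 [h [hq2 hc]]]]] := cocycle_on_finite_cover oO q1O Ou Ov Oind rA.
have [f [M [fM fr [[q0 m0] [w [wp we]]]]]] := cocycle_on_infinite_cover oO Ou Ov rA cO cr.
set B := zext A c in fr wp we.
have BE W q m : act B W (q, m) = (act A W q, m + zco A c W q)%R by apply: act_zext.
have rB p : act B r p = p by case: p => q m; rewrite BE rA cr GRing.addr0.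
have [C cC] : exists C : nat, forall x q, (`|c x q| <= C)%N.
  exists (\max_(e : bool * Om) `|c e.1 e.2|%N) => x q.
  exact: (leq_bigmax (x, q)).
(* Transitivity carries the loop [h] to the base point [q0] without changing its value. *)
have [h1 [h1q h1c]] : exists h1 : F2, act A h1 q0 = q0 /\ zco A c h1 q0 != 0%R.
  have [g gq] := transA q0 q2; exists (g * h * g^-1).
  have gV : act A g^-1 q2 = q0 by rewrite -gq actK.
  split; first by rewrite !actM gq hq2 gV.
  by rewrite !zcoM !actM gq hq2 zcoV gV GRing.addrAC GRing.addrN GRing.add0r.
have f0 x q m : ~ (0 <= m < M%:Z)%R -> f x (q, m) = 0%R.
  by move=> nm; apply: contrapT => /fM.
(* [bb] bounds the reach of [r] and [w] and the base level. The period [k] leaves gaps wider than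
   twice [bb], so neither word can meet two copies of [f]. *)
pose bb := (C * size (fword r) + C * size (fword w) + `|m0|)%N.
pose k' := (M + 2 * bb)%N; pose k : int := Posz k'.+1.
have k_gt0 : k != 0%R by [].
(* The k-periodic copies of f, the j-th one having values in s^j <z> s^-j. *)
pose mu x (p : Om * int) : F2 :=
  gpow true (f x (p.1, (p.2 %% k)%Z)) ^ (gpow false (p.2 %/ k)%Z)^-1.
have mu_shift i x q m : mu x (q, m + i * k)%R = mu x (q, m) ^ (gpow false i)^-1.
  by rewrite /mu /= GRing.addrC divzMDl // modzMDl -conjgM -invgM -gpowD.
have coc_mu_shift i W q m : coc B mu W (q, m + i * k)%R = coc B mu W (q, m) ^ (gpow false i)^-1.
  exact/coc_shift/mu_shift.
(* From level [m], only the copy numbered by the quotient of [m + bb] by [k] is within reach. *)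
have coc_mu_local W q m : (C * size (fword W) <= bb)%N ->
    coc B mu (fword W) (q, m) =
    gpow true (zco B f (fword W) (q, m - ((m + Posz bb) %/ k)%Z * k)%R)
      ^ (gpow false ((m + Posz bb) %/ k)%Z)^-1.
  move=> Wb; set j := ((m + Posz bb) %/ k)%Z.
  pose f' x (p : Om * int) := f x (p.1, p.2 - j * k)%R.
  have -> : zco B f W (q, m - j * k)%R = zco B f' W (q, m).
    rewrite -{2}[m](GRing.subrK (j * k)%R); symmetry; apply: zco_shift => x q' m'.
    by rewrite /f' /= GRing.addrK.
  apply: (@coc_local _ _ A c C cC _ mu f' (fun i => gpow true i ^ (gpow false j)^-1)).
    by move=> i i'; rewrite gpowD conjMg.
  move=> x q' m' le; rewrite /mu /f' /=.
  have jm : m = (j * k + ((m + Posz bb) %% k)%Z - Posz bb)%R.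
    by rewrite /j; have := divz_eq (m + Posz bb) k; lia.
  have rk : (0 <= ((m + Posz bb) %% k)%Z < k)%R.
    by rewrite modz_ge0 // ltz_pmod.
  have mkk : k = (Posz M + 2 * Posz bb + 1)%R by rewrite /k /k'; lia.
  have [pos|neg] := pselect (0 <= m' - j * k)%R.
    have [] := @divz_modz_small k j (m' - j * k)%R; first by lia.
    rewrite (_ : (j * k + (m' - j * k))%R = m') => [-> -> //|].
    by rewrite GRing.addrC GRing.subrK.
  have [] := @divz_modz_small k (j - 1)%R (m' - j * k + k)%R; first by lia.
  rewrite (_ : ((j - 1) * k + (m' - j * k + k))%R = m') => [-> ->|]; last by ring.
  by rewrite !f0 ?gpow0 ?conj1g //; lia.
have coc_r p : coc B mu r p = 1.
  case: p => q m; rewrite coc_mu_local; last by rewrite /bb; lia.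
  by rewrite fr gpow0 conj1g.
pose p : Om * int := (q0, m0).
pose E := cext B mu.
have EE W t y : act E W (t, y) = (act B W t, y * coc B mu W t) by apply: act_cext.
have RE s t : [set r] s -> act E s t = t.
  by move=> ->; case: t => t y; rewrite EE rB coc_r mulg1.
pose pos (g : G) := act B (repr g) p; pose lab (g : G) := coc B mu (repr g) p.
have RB s t : [set r] s -> act B s t = t by move=> ->; apply: rB.
have posM g g' : pos (g * g') = act B (repr g') (pos g) by rewrite /pos (act_reprM RB).
have labM g g' : lab (g * g') = lab g * coc B mu (repr g') (pos g).
  have := act_reprM RE g g' (p, 1); rewrite !EE !mul1g => -[_].
  by [].
have pos1 : pos 1 = p by rewrite /pos (act_repr1 RB).
pose H : set G := [set g | exists i, pos g = (q0, m0 + i * k)%R].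
have act_shift W q m i :
    act B W (q, m + i * k)%R = ((act B W (q, m)).1, (act B W (q, m)).2 + i * k)%R.
  by rewrite !BE /= GRing.addrAC.
(* A shift by [i] periods conjugates labels by a power of [s]. Appending the power of [s] that
   counts the periods crossed absorbs this, and the cocycle becomes a homomorphism on [H]. *)
pose th (g : G) : F2 := lab g * gpow false (((pos g).2 - m0) %/ k)%Z.
have divk i : (((m0 + i * k)%R - m0) %/ k)%Z = i.
  by rewrite GRing.addrAC GRing.addrN GRing.add0r mulzK.
have thM g g' : H g -> H g' -> th (g * g') = th g * th g'.
  move=> [i gi] [j gj]; rewrite /th labM posM gi act_shift -/p -/(pos g') gj /= coc_mu_shift.
  rewrite -/p -/(lab g') (_ : (m0 + j * k + i * k)%R = (m0 + (j + i) * k)%R); last by ring.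
  rewrite !divk conjgE invgK.
  by rewrite GRing.addrC gpowD !mulgA mulgVK.
have H1 : H 1 by exists 0%R; rewrite pos1 GRing.mul0r GRing.addr0.
have HM g g' : H g -> H g' -> H (g * g').
  move=> [i gi] [j gj]; exists (j + i)%R.
  by rewrite posM gi act_shift -/p -/(pos g') gj /= -GRing.addrA -GRing.mulrDl.
have HVg g : H g -> H g^-1.
  move=> [i gi]; exists (- i)%R; have := posM g g^-1.
  rewrite mulgV pos1 gi act_shift -/p -/(pos g^-1).
  case: (pos g^-1) => q m; rewrite /p => -[-> ->].
  by rewrite GRing.mulNr GRing.addrK.
have sH : subgroup H by split.
have fiH : finite_index H.
  (* The position of the inverse of [g], with its level taken modulo [k], determines the left coset
     of [g] by [H]. *)
  split=> //; pose key (g : G) : Om * 'I_k'.+1 :=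
    ((pos g^-1).1, inord `|((pos g^-1).2 %% k)%Z|%N).
  apply: (@finite_range_key _ _ _ _ key) => g g' [eq1 eq2].
  have eqm : ((pos g^-1).2 %% k)%Z = ((pos g'^-1).2 %% k)%Z.
    have bnd x : ((`|(x %% k)%Z|)%N < k'.+1)%N.
      have := modz_ge0 x k_gt0; have : (0 < k)%R by []; move=> /(ltz_pmod x).
      by rewrite /k; lia.
    have /(congr1 val) /= := eq2; rewrite !inordK ?bnd // => e.
    have := modz_ge0 (pos g^-1).2 k_gt0; have := modz_ge0 (pos g'^-1).2 k_gt0; lia.
  have Hgg' : H (g^-1 * g').
    have g'1 : act B (repr g') (pos g'^-1) = p by rewrite -posM mulVg pos1.
    move: eq1 eqm g'1; rewrite /H /= posM.
    move: (pos g^-1) (pos g'^-1) => [x i] [x' i'] /= -> e g'1.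
    exists ((i %/ k)%Z - (i' %/ k)%Z)%R.
    have {1}-> : i = (i' + ((i %/ k)%Z - (i' %/ k)%Z) * k)%R.
      have := divz_eq i' k; have := divz_eq i k; rewrite e.
      by move: (i %/ k)%Z (i' %/ k)%Z (i' %% k)%Z => y y' z -> ->; ring.
    by rewrite act_shift g'1.
  apply/seteqP; split=> _ [x Hx <-].
    exists (g'^-1 * g * x); last by rewrite !mulgA mulgV mul1g.
    by apply: HM => //; have := HVg _ Hgg'; rewrite invgM invgK.
  by exists (g^-1 * g' * x); [apply: HM | rewrite !mulgA mulgV mul1g].
pose S : set F2 := th @` H.
have th1 : th 1 = 1 by apply: (mulgI (th 1)); rewrite -thM ?mulg1.
have sS : subgroup S.
  split; first by exists 1.
  - by move=> _ _ [g Hg <-] [g' Hg' <-]; exists (g * g'); [apply: HM | rewrite thM].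
  - move=> _ [g Hg <-]; exists g^-1; first exact: HVg.
    by apply/esym/mulg1_eq; rewrite -thM ?mulgV //; apply: HVg.
have posW (W : F2) : pos (\pi_G W) = act B W p by apply: act_repr.
have labW (W : F2) : lab (\pi_G W) = coc B mu W p.
  by have := act_repr RE W (p, 1); rewrite !EE !mul1g => -[].
have j0 : ((m0 + Posz bb) %/ k)%Z = 0%R by rewrite divz_small // /k /k' /bb; lia.
have thw : th (\pi_G w) = gpow true (zco B f w p).
  rewrite /th posW labW wp coc_mu_local; last by rewrite /bb; lia.
  by rewrite j0 GRing.mul0r GRing.subr0 GRing.subrr div0z gpow0 invg1 conjg1 mulg1.
have coc_sig W t : sig false (coc B mu W t) = 0%R.
  elim: W t => [|l W IH] t //=; rewrite sigM IH GRing.addr0 /cocl /=.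
  by case: l.2; rewrite ?sigV sigJ sig_gpow.
(* This power of [h1] climbs a nonzero multiple of [k] levels, so it lies in [H]. *)
pose W := h1 ^+ k'.+1.
have posWn n : act B (h1 ^+ n) p = (q0, m0 + Posz n * zco A c h1 q0)%R.
  elim: n => [|n IH]; first by rewrite GRing.mul0r GRing.addr0.
  rewrite expgSr actM IH BE h1q; congr (_, _).
  by rewrite (_ : Posz n.+1 = (Posz n + 1)%R); [ring | lia].
have posWE : pos (\pi_G W) = (q0, m0 + zco A c h1 q0 * k)%R.
  by rewrite posW posWn GRing.mulrC.
have thW : sig false (th (\pi_G W)) = zco A c h1 q0.
  by rewrite /th sigM labW coc_sig posWE divk sig_gpow GRing.add0r.
have [theta [thetaM thetaS]] : exists theta : F2 -> F2,
    (forall x y, S x -> S y -> theta (x * y) = theta x * theta y) /\ theta @` S = setT.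
  apply: subgroup_onto_F2 => //; exists (th (\pi_G w)), (th (\pi_G W)); split.
  - by exists (\pi_G w) => //; exists 0%R; rewrite posW wp GRing.mul0r GRing.addr0.
  - by exists (\pi_G W) => //; exists (zco A c h1 q0).
  move=> /commute_exponents; rewrite thW thw !sig_gpow /= GRing.mul0r => /esym/eqP.
  by rewrite GRing.mulf_eq0 (negbTE h1c) (negbTE we).
exists H, bool, (fun g => theta (th g)); split=> //.
- exact: F2_nonabelian.
- by move=> x y Hx Hy; rewrite thM // thetaM //; [exists x | exists y].
- apply/seteqP; split=> // y _; have : (theta @` S) y by rewrite thetaS.
  by move=> [_ [g Hg <-] <-]; exists g.
Qed.
End Large.

(** * Finite quotients and the commutator subgroup *)

(** The image acts on itself by right multiplication. If the orbit of 1 under [u] and [v] were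
    proper, [large_of_intransitive] would apply; so every element is a product of the commuting
    elements [phi u] and [phi v]. *)
Lemma abelian_finite_image (gT : finGroupType) (phi : F2 -> gT) (u v : F2) :
  {morph phi : x y / x * y} -> phi (u * v * u^-1 * v^-1) = 1 ->
  ~ large (presented_group [set (u * v * u^-1 * v^-1 : F2)]) ->
  forall x y, commute (phi x) (phi y).
Proof.
move=> phiM phir nl.
have phi1 : phi 1 = 1 by apply: (mulgI (phi 1)); rewrite -phiM !mulg1.
have phiV x : phi x^-1 = (phi x)^-1 by apply/esym/mulg1_eq; rewrite -phiM mulgV phi1.
pose im (x : gT) : bool := `[< exists w, x = phi w >].
pose Om : finType := {x : gT | im x}.
have imM (s : Om) w : im (val s * phi w).
  by have /asboolP[w' e] := valP s; apply/asboolP; exists (w' * w); rewrite phiM e.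
pose mulr (s : Om) (w : F2) : Om := Sub (val s * phi w) (imM s w).
have gK x : cancel (fun s => mulr s (fgen x)) (fun s => mulr s (fgen x)^-1).
  by move=> s; apply: val_inj; rewrite /= phiV mulgK.
have g'K x : cancel (fun s => mulr s (fgen x)^-1) (fun s => mulr s (fgen x)).
  by move=> s; apply: val_inj; rewrite /= phiV mulgVK.
pose A := bij_action gK g'K.
have AE (w : F2) s : act A w s = mulr s w.
  apply: val_inj; rewrite /= -{2}[w]fmk_word; elim: (fword w) s => [|l t IH] s.
    by rewrite phi1 mulg1.
  rewrite /= IH -[l :: t]cat1s fmk_cat phiM mulgA; congr (_ * _).
  by case: l => x [] //=; rewrite fmk_neg.
have im1 : im 1 by apply/asboolP; exists 1.
pose o : Om := Sub 1 im1.
pose e : rel Om := [rel s t | (t == act A u s) || (t == act A v s)].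
pose O : {set Om} := finset (connect e o).
have oO : o \in O by rewrite inE.
have Ou q : q \in O -> act A u q \in O.
  by rewrite !inE => /connect_trans; apply; apply: connect1; apply/orP; left; apply: eqxx.
have Ov q : q \in O -> act A v q \in O.
  by rewrite !inE => /connect_trans; apply; apply: connect1; apply/orP; right; apply: eqxx.
have Oind (P : Om -> Prop) : P o ->
    (forall q, q \in O -> P q -> P (act A u q) /\ P (act A v q)) -> forall q, q \in O -> P q.
  move=> Po PS q; rewrite inE => /connectP[p + ->].
  have : forall s, s \in O -> P s -> path e s p -> P (last s p); last by apply.
  elim: p => [|s p IH] t tO Pt //= /andP[/orP[] /eqP -> pp]; have [P1 P2] := PS t tO Pt.
    by apply: IH pp => //; apply: Ou.
  by apply: IH pp => //; apply: Ov.
have rA q : act A (u * v * u^-1 * v^-1 : F2) q = q.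
  by rewrite AE; apply: val_inj; rewrite /= phir mulg1.
have transA q q' : exists w : F2, act A w q = q'.
  have /asboolP[w wE] := valP q; have /asboolP[w' w'E] := valP q'.
  exists (w^-1 * w'); rewrite AE; apply: val_inj; rewrite /= wE w'E.
  by rewrite phiM phiV mulgA mulgV mul1g.
have Ofull q : q \in O.
  by apply/negPn/negP => qO; apply: nl; exact: (large_of_intransitive oO qO Ou Ov Oind rA transA).
have uv : commute (phi u) (phi v).
  by move: phir; rewrite !phiM !phiV -mulgA -invgM => /divg1_eq; rewrite /commute -phiM -phiM.
have cuv (q : Om) : commute (val q) (phi u) /\ commute (val q) (phi v).
  apply: (Oind (fun q : Om => commute (val q) (phi u) /\ commute (val q) (phi v))) => //.
    by split; apply/commute_sym/commute1.
  move=> s _ [su sv]; rewrite !AE /=.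
  by split; split; apply/commute_sym/commuteM; by apply/commute_sym.
have call (q q' : Om) : commute (val q) (val q').
  apply: (Oind (fun q' : Om => commute (val q) (val q'))) => //; first exact: commute1.
  move=> s _ qs; have [cu cv] := cuv q; rewrite !AE /=.
  by split; apply: commuteM.
move=> x y.
have imp w : im (phi w) by apply/asboolP; exists w.
exact: (call (Sub (phi x) (imp x)) (Sub (phi y) (imp y))).
Qed.

Lemma finite_index_cosets (G : groupType) (H : set G) : finite_index H ->
  exists (T : finType) (e : G -> T) (sec : T -> G),
    (forall t, e (sec t) = t) /\ (forall g g', e g = e g' <-> H (g^-1 * g')).
Proof.
move=> [[H1 HM HV] /finite_fsetP[X XE]].
have inX g : [set g * h | h in H] \in X.
  have : range (fun g : G => [set g * h | h in H]) [set g * h | h in H] by exists g.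
  by rewrite XE.
pose e g : X := FSetSub (inX g).
have /choice[sec secP] : forall t : X, exists g, e g = t.
  move=> t; have : [set` X] (val t) by apply: (valP t).
  by rewrite -XE => -[g _ ge]; exists g; apply: val_inj.
exists X, e, sec; split=> // g g'; split=> [/(congr1 val) /= E|Hgg'].
  have : [set g' * h | h in H] g' by exists 1; rewrite ?mulg1.
  by rewrite -E => -[h Hh <-]; rewrite mulKg.
apply: val_inj => /=; apply/seteqP; split=> _ [x Hx <-].
  exists (g'^-1 * g * x); last by rewrite !mulgA mulgV mul1g.
  by apply: HM => //; have := HV _ Hgg'; rewrite invgM invgK.
by exists (g^-1 * g' * x); [apply: HM | rewrite !mulgA mulgV mul1g].
Qed.

Lemma commutator_subgroup_subgroup (G : groupType) : subgroup (@commutator_subgroup G).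
Proof.
split=> [K [[]] //|x y Dx Dy K [sK cK]|x Dx K [sK cK]]; have [_ KM KV] := sK.
  by apply: KM; [apply: Dx | apply: Dy].
by apply: KV; apply: Dx.
Qed.

Lemma commutator_subgroup_comm (G : groupType) (x y : G) : commutator_subgroup [~ x, y].
Proof. by move=> K [_]; apply; exists x, y. Qed.

Lemma commutator_subgroupJ (G : groupType) (x g : G) :
  commutator_subgroup x -> commutator_subgroup (x ^ g).
Proof.
have [_ DM _] := commutator_subgroup_subgroup G; move=> Dx.
have -> : x ^ g = x * [~ x, g] by rewrite commgEl mulVKg.
by apply: DM => //; apply: commutator_subgroup_comm.
Qed.

Section Quotients.
Variables (u v : F2).
Local Notation r := (u * v * u^-1 * v^-1 : F2).
Local Notation G := (presented_group [set r]).
Local Notation pi := (\pi_G).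

Lemma sig_relator x : sig x r = 0%R.
Proof. by rewrite !sigM !sigV; lia. Qed.

Lemma pi_relator : pi r = 1 :> G.
Proof. by apply/presP; exact (normal_closure_sub (erefl _)). Qed.

Lemma pi_one : pi 1 = 1 :> G. Proof. by []. Qed.

Definition psig (x : bool) (g : G) : int := sig x (repr g).

Lemma psig_pi x (w : F2) : psig x (pi w) = sig x w.
Proof.
rewrite /psig; case: piP => w' /pres_eqP N.
have : sig x (w^-1 * w') = 0%R.
  by apply: (sig_normal_closure _ N) => _ ->; apply: sig_relator.
rewrite sigM sigV => /eqP; rewrite GRing.addrC GRing.subr_eq0 => /eqP.
by [].
Qed.

Lemma psigM x (g h : G) : psig x (g * h) = (psig x g + psig x h)%R.
Proof.
elim/quotW: g => g; elim/quotW: h => h.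
by rewrite -pres_pi_morph !psig_pi sigM.
Qed.

Lemma psigV x (g : G) : psig x g^-1 = (- psig x g)%R.
Proof. by elim/quotW: g => g; rewrite -pres_pi_inv !psig_pi sigV. Qed.

(** These subgroups witness the residual finiteness of the abelianisation. *)
Lemma finite_index_psig x (n : nat) : (0 < n)%N ->
  finite_index [set g : G | (Posz n %| psig x g)%Z].
Proof.
move=> n0; split; first split=> /=.
- by rewrite -pi_one psig_pi dvdz0.
- by move=> g h Hg Hh; rewrite psigM; apply: GRing.rpredD.
- by move=> g Hg; rewrite psigV GRing.rpredN.
case: n n0 => // n _.
pose key (g : G) : 'I_n.+1 := inord `|(psig x g %% Posz n.+1)%Z|%N.
apply: (@finite_range_key _ _ _ _ key) => g g' E.
have Egg' : (psig x g = psig x g' %[mod Posz n.+1])%Z.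
  have n0 : Posz n.+1 != 0%R by [].
  have bnd i : ((`|(i %% Posz n.+1)%Z|)%N < n.+1)%N.
    have := modz_ge0 i n0; have : (0 < Posz n.+1)%R by []; move=> /(ltz_pmod i).
    by lia.
  have /(congr1 val) /= := E; rewrite !inordK ?bnd // => e.
  have := modz_ge0 (psig x g) n0; have := modz_ge0 (psig x g') n0; lia.
have dv h h' y : (psig x h = psig x h' %[mod Posz n.+1])%Z -> (Posz n.+1 %| psig x y)%Z ->
    (Posz n.+1 %| psig x (h'^-1 * h * y))%Z.
  move=> /eqP; rewrite eqz_mod_dvd => d1 d2; rewrite !psigM psigV.
  by apply: GRing.rpredD => //; rewrite GRing.addrC.
apply/seteqP; split=> _ [y Hy <-].
  by exists (g'^-1 * g * y); [apply: dv | rewrite !mulgA mulgV mul1g].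
by exists (g^-1 * g' * y); [apply: dv | rewrite !mulgA mulgV mul1g].
Qed.

(** Modulo commutators each word equals the normal form [m], a power of [a] times a power of [b];
    this is checked letter by letter. *)
Lemma commutator_of_psig0 (g : G) : psig false g = 0%R -> psig true g = 0%R ->
  commutator_subgroup g.
Proof.
pose D := @commutator_subgroup G; have [D1 DM DV] := commutator_subgroup_subgroup G.
elim/quotW: g => w; rewrite !psig_pi => s1 s2.
pose m (w : seq (bool * bool)) : G := pi (gpow false (sig false w)) * pi (gpow true (sig true w)).
suff: D (pi (fmk w) * (m w)^-1).
  by rewrite fmk_word /m s1 s2 !gpow0 !pi_one mulg1 invg1 mulg1.
elim: (fword w) => [|l t IH].
  by rewrite /m /= !gpow0 [pi (fmk [::])]pi_one ?pi_one mulg1 invg1 mulg1.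
have -> : pi (fmk (l :: t)) * (m (l :: t))^-1 =
    (pi (fmk t) * (m t)^-1) ^ (pi (fmk [:: l]))^-1 * (pi (fmk [:: l]) * m t * (m (l :: t))^-1).
  have gen (x y z z' : G) : x * y * z'^-1 = (y * z^-1) ^ x^-1 * (x * z * z'^-1).
    by rewrite conjgE invgK !mulgA !mulgVK.
  by rewrite -cat1s fmk_cat pres_pi_morph; apply: gen.
apply: DM; first exact: commutator_subgroupJ.
have lE : fmk [:: l] = gpow l.1 (if l.2 then -1 else 1)%R by case: l => x [].
rewrite lE /m /= /xsig; case: l {lE} => -[] e /=; rewrite GRing.add0r.
  set z := (if e then _ else _).
  have gen (x y z' : G) : x * (y * z') * (y * (x * z'))^-1 = [~ x^-1, y^-1].
    by rewrite commgEl conjgE !invgM !invgK !mulgA mulgK.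
  rewrite gpowD [pi (gpow _ z * _)]pres_pi_morph gen.
  exact: commutator_subgroup_comm.
by rewrite gpowD pres_pi_morph mulgA mulgV.
Qed.

(** The action on the cosets of a finite index subgroup [H] has abelian image by
    [abelian_finite_image], so commutators fix the coset [H] and lie in it. Conversely, the
    subgroups of [finite_index_psig] force both exponent sums to vanish. *)
Lemma residually_abelianised : ~ large G ->
  \bigcap_(H in @finite_index G) H = @commutator_subgroup G.
Proof.
move=> nl; apply/seteqP; split=> g Hg; last first.
  move=> H fH; apply: Hg; split; first by case: fH.
  move=> _ [x [y ->]]; elim/quotW: x => x; elim/quotW: y => y.
  have [T [e [sec [secK eP]]]] := finite_index_cosets fH.
  have e_act (h : G) g1 g2 : e g1 = e g2 -> e (h * g1) = e (h * g2).
    by rewrite !eP invgM -(mulgA g1^-1) mulKg.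
  (* Permutations compose from left to right, so the inverse is what makes [phi] multiplicative. *)
  pose p (h : G) t := e (h^-1 * sec t).
  have p_inj h : injective (p h).
    by move=> t t' /(e_act h); rewrite !mulVKg !secK.
  pose phi (w : F2) : {perm T} := perm (p_inj (pi w)).
  have phiM : {morph phi : w w' / w * w'}.
    move=> w w'; apply/permP => t; rewrite permM !permE /p pres_pi_morph invgM -(mulgA (pi w')^-1).
    by apply: e_act; rewrite secK.
  have phir : phi r = 1.
    by apply/permP => t; rewrite permE perm1 /p pi_relator invg1 mul1g secK.
  have phi1 : phi 1 = 1 by apply: (mulgI (phi 1)); rewrite -phiM !mulg1.
  have phiV w : phi w^-1 = (phi w)^-1 by apply/esym/mulg1_eq; rewrite -phiM mulgV phi1.
  have cxy : phi [~ x, y] = 1.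
    rewrite commgEl /conjg !phiM !phiV -[RHS](mulVg (phi x)); congr (_ * _).
    by rewrite (abelian_finite_image phiM phir nl x y) mulKg.
  have := congr1 (fun s : {perm T} => s (e 1)) cxy.
  rewrite permE perm1 /p => E.
  have : e ((pi [~ x, y])^-1 * 1) = e 1.
    by rewrite -E; apply: e_act; rewrite secK.
  rewrite mulg1 eP invgK mulg1; congr (H _).
  by rewrite /commg /conjg !pres_pi_morph !pres_pi_inv.
have sg0 x : psig x g = 0%R.
  (* A modulus larger than the absolute value of the exponent sum can divide it only if it is 0. *)
  have n0 : (0 < (`|psig x g|).+1)%N by [].
  have := Hg _ (finite_index_psig x n0); rewrite /= dvdzE /=.
  by case: (`|psig x g|%N =P 0%N) => [|nz] /= ; [lia | move=> /dvdn_leq; lia].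
exact: commutator_of_psig0.
Qed.
End Quotients.

Theorem corollary6p1 (u v : F2) :
  let r : F2 := u * v * u^-1 * v^-1 in
  let G : groupType := presented_group [set r] in
  ~ cyclic_conjugate (cyc_reduce (fword r)) (fword (a * b * a^-1 * b^-1)) ->
  ~ cyclic_conjugate (cyc_reduce (fword r)) (fword (b * a * b^-1 * a^-1)) ->
  large G \/ NARA G.
Proof.
move=> r G n1 n2; have [lG|nl] := pselect (large G); [by left | right].
split; first exact: presented_finitely_generated.
  move=> /(_ (\pi_G a) (\pi_G b)) ab.
  have [] : cyclic_conjugate (cyc_reduce (fword r)) (fword (a * b * a^-1 * b^-1)) \/
      cyclic_conjugate (cyc_reduce (fword r)) (fword (b * a * b^-1 * a^-1)); last 2 first.
  - exact: n1.
  - exact: n2.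
  apply: relator_of_abelian; try exact: sig_relator.
  apply/presP; rewrite !pres_pi_morph !pres_pi_inv.
  by rewrite ab mulgK mulgV.
exact: residually_abelianised.
Qed.
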